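(* Let $p,r\ge 2$ be integers and $i$ an integer with $i\ge p-1$ and $i\ge 1$. There is a constant $C_{p,r,i}$ depending only on $p,r,i$ such that every flag $(d-1)$-dimensional simplicial complex $\Gamma$ with $n$ vertices and $\mathrm{gr}_{p-1}(\Gamma)>2p+2r-4$ satisfies $$f_{i-1}(\Gamma)\le C_{p,r,i}\, d^{\,i-a_{p,r,i}}\,n^{\,a_{p,r,i}}.$$
   Context: A simplicial complex $\Gamma$ on a finite vertex set $V=V(\Gamma)$ is a family of subsets of $V$ (faces) closed under taking subsets; its dimension is $\max\{|F|:F\in\Gamma\}-1$; $f_j(\Gamma)$ is the number of faces with $j+1$ elements. $\Gamma$ is flag if every vertex set all of whose 2-element subsets are faces is itself a face. For $W\subseteq V$, $\Gamma[W]=\{F\in\Gamma:F\subseteq W\}$; for a face $F$ (possibly empty), $\mathrm{lk}_\Gamma(F)=\{G\setminus F: F\subseteq G\in\Gamma\}$. Fix a field $\mathbf{k}$; $\tilde H_j(\cdot;\mathbf{k})$ is reduced simplicial homology. The $(p-1)$-girth is $\mathrm{gr}_{p-1}(\Gamma)=\min\{|W|: W\subseteq V(\Gamma),\ \tilde H_{p-1}(\mathrm{lk}_\Gamma(F)[W];\mathbf{k})\neq 0 \text{ for some face } F\in\Gamma \text{ (including } F=\emptyset)\}$, or $\infty$ if none exists. The exponents are defined recursively: $a_{2,r,i}=1+1/r+\cdots+1/r^{i-1}$ for $i\ge1$; for $p\ge 3$, $a_{p,r,p-1}=p-1$ and $a_{p,r,i}=\tfrac12 a_{p-1,r,i-1}+\tfrac12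 a_{p,r,i-1}+1$ for $i\ge p$. *)

(* Defs.v *)
From HB Require Import structures.
From mathcomp Require Import all_boot all_order all_algebra.
From Stdlib Require Import Reals.
Set Implicit Arguments. Unset Strict Implicit. Unset Printing Implicit Defensive.
Import GRing.Theory.

Definition is_complex n (Gamma : {set {set 'I_n}}) : Prop :=
  forall F G : {set 'I_n}, F \in Gamma -> G \subset F -> G \in Gamma.

Definition all_vertices n (Gamma : {set {set 'I_n}}) : Prop :=
  forall v : 'I_n, [set v] \in Gamma.

Definition has_dim_pred n (Gamma : {set {set 'I_n}}) (d : nat) : Prop :=
  (forall F, F \in Gamma -> #|F| <= d) /\ (exists2 F, F \in Gamma & #|F| = d).

Definition is_flag n (Gamma : {set {set 'I_n}}) : Prop :=
  forall W : {set 'I_n},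
    (forall u v, u \in W -> v \in W -> [set u; v] \in Gamma) -> W \in Gamma.

(* f_j(Gamma) = number of faces with j+1 elements; fvec Gamma k = #faces of size k *)
Definition nfaces n (Gamma : {set {set 'I_n}}) (k : nat) : nat :=
  #|[set F in Gamma | #|F| == k]|.

Definition induced n (Gamma : {set {set 'I_n}}) (W : {set 'I_n}) :=
  [set F in Gamma | F \subset W].

Definition link n (Gamma : {set {set 'I_n}}) (F : {set 'I_n}) :=
  [set G :\: F | G in [set G in Gamma | F \subset G]].

(* Reduced simplicial chain complex over a field K.  Chains of all degrees
   live in K^{ {set 'I_n} } (row vectors indexed by subsets, the empty set
   giving the augmentation degree -1).  [bd] is the simplicial boundary
   map of the full simplex on 'I_n with the standard signs for the order of
   'I_n:  d[v_0<...<v_j] = sum_k (-1)^k [v_0..^v_k..v_j], d[v] = [empty]. *)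
Local Open Scope ring_scope.
Definition bd (K : fieldType) n : 'M[K]_(#|[set: {set 'I_n}]|) :=
  \matrix_(i, j)
    let F : {set 'I_n} := @enum_val _ [set: {set 'I_n}] i in
    let G : {set 'I_n} := @enum_val _ [set: {set 'I_n}] j in
    if (G \subset F) && (#|F :\: G| == 1%N) then
      ((-1) ^+ #|[set u in G | [exists v in F :\: G, ltn (val u) (val v)]]|)
    else 0.

(* projection onto the span of the j-faces of Delta (chain group C_j) *)
Definition chains (K : fieldType) n (Delta : {set {set 'I_n}}) (j : nat)
  : 'M[K]_(#|[set: {set 'I_n}]|) :=
  diag_mx (\row_i (if (@enum_val _ [set: {set 'I_n}] i \in Delta) &&
                      (#|@enum_val _ [set: {set 'I_n}] i| == j.+1)
                   then 1 else 0)).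

Definition homology_nonzero (K : fieldType) n (Delta : {set {set 'I_n}})
  (j : nat) : bool :=
  ~~ ((chains K Delta j :&: kermx (bd K n)) <= chains K Delta j.+1 *m bd K n)%MS.

Local Close Scope ring_scope.

(* gr_j(Gamma) = min { |W| : W in girth_witnesses }, or infinity if empty *)
Definition girth_witnesses (K : fieldType) n (Gamma : {set {set 'I_n}})
  (j : nat) : {set {set 'I_n}} :=
  [set W : {set 'I_n} | [exists F in Gamma,
                           homology_nonzero K (induced (link Gamma F) W) j]].

(* gr_j(Gamma) > m  (true also when gr_j = infinity) *)
Definition girth_gt (K : fieldType) n (Gamma : {set {set 'I_n}})
  (j m : nat) : Prop :=
  forall W, W \in girth_witnesses K Gamma j -> (m < #|W|)%N.

(* exponents a_{p,r,i} (junk values outside the range i >= p-1, p >= 2) *)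
Fixpoint a2 (r i : nat) : R :=
  match i with
  | 0%nat => 0%R
  | S i' => Rplus (a2 r i') (Rinv (pow (INR r) i'))
  end.

Fixpoint aexp (p r i : nat) : R :=
  match p with
  | 0%nat => 0%R
  | 1%nat => 0%R
  | 2%nat => a2 r i
  | S p' =>
      (fix g (i : nat) : R :=
         match i with
         | 0%nat => 0%R
         | S i' => if Nat.leb i p' then INR p'
                   else Rplus (Rplus (Rmult (Rinv 2) (aexp p' r i'))
                                     (Rmult (Rinv 2) (g i'))) 1
         end) i
  end.

(* Main.v *)
From Stdlib Require Import Reals Lra.
Require Import Defs.
From HB Require Import structures.
From mathcomp Require Import all_boot all_order all_algebra.
From mathcomp Require Import zify.
Set Implicit Arguments. Unset Strict Implicit. Unset Printing Implicit Defensive.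
Import Order.TTheory GRing.Theory Num.Theory.

(** The girth hypothesis is used only through induced subgraphs of the 1-skeleton
    that are iterated suspensions of the empty graph or of a cycle: their flag
    complexes are spheres, so top-dimensional cycles give nonzero homology.

    For p = 2 the graph has no induced cycle of length 4, ..., 2r.  Then walks
    v_0, ..., v_r with v_j, v_(j+2) distinct and nonadjacent are induced, and for
    fixed ends their second vertices form a clique, so there are at most
    n^2 d^(r-1) of them.  On the other hand neighbourhoods that are large compared
    with d are sparse, so if the minimum degree D is at least a constant times d
    then most random walks are of this kind, which forces D^r = O(n d^(r-1)).
    Deleting vertices of small degree one at a time and inducting on i inside
    their neighbourhoods gives the bound.

    For p >= 3, the common neighbourhood of two nonadjacent vertices satisfies the
    hypothesis for p - 1.  Let F_i count the i-cliques.  A large link of a clique has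
    a positive proportion of nonadjacent pairs, since otherwise a greedy choice
    yields an induced cross-polytope.  Counting triples (x, y, A) with x, y
    nonadjacent and A an i-clique in their common neighbourhood, Cauchy-Schwarz
    then gives F_(i+1)^2 <= F_i * (O(M n^2) + O(d^2 F_i)), where M is the largest
    number of i-cliques in such a common neighbourhood. *)

(** * Cliques and spheres in a graph *)

Section Graph.
Variables (T : finType) (e : rel T).

Definition clique (A : {set T}) : bool :=
  [forall u in A, forall v in A, (u != v) ==> e u v].

Lemma cliqueP (A : {set T}) :
  reflect {in A &, forall u v, u != v -> e u v} (clique A).
Proof.
apply: (iffP forall_inP) => [h u v uA vA uv | h u uA].
  by have /forall_inP/(_ v vA)/implyP := h u uA; apply.
by apply/forall_inP => v vA; apply/implyP => uv; apply: h.
Qed.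

Lemma clique_sub (A B : {set T}) : A \subset B -> clique B -> clique A.
Proof.
by move=> /subsetP AB /cliqueP cB; apply/cliqueP => u v uA vA; apply: cB; apply: AB.
Qed.

Definition cliques (S : {set T}) (i : nat) : {set {set T}} :=
  [set A : {set T} | [&& A \subset S, clique A & #|A| == i]].

Definition clique_bound (S : {set T}) (d : nat) : Prop :=
  forall A : {set T}, A \subset S -> clique A -> #|A| <= d.

Definition nbr (S : {set T}) (v : T) : {set T} := [set w in S | e v w].

Definition nonadj (x y : T) : bool := (x != y) && ~~ e x y.

(* [sphere p W] makes the flag complex on [W] a triangulated (p-1)-sphere:
   an iterated suspension of the empty complex or of an induced cycle
   u, f 0, ..., f k of length k + 2 >= 4. *)
Inductive sphere : nat -> {set T} -> Prop :=
| sphere_empty : sphere 0 set0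
| sphere_hole (u : T) (f : nat -> T) (k : nat) :
    2 <= k ->
    (forall j, j < k -> e (f j) (f j.+1)) ->
    (forall i j, i < j -> j <= k -> f i != f j) ->
    (forall i j, i.+1 < j -> j <= k -> ~~ e (f i) (f j)) ->
    (forall j, j <= k -> f j != u) ->
    e u (f 0) -> e u (f k) ->
    (forall j, 0 < j -> j < k -> ~~ e u (f j)) ->
    sphere 2 (u |: [set f (val j) | j : 'I_k.+1])
| sphere_susp (p : nat) (a b : T) (W : {set T}) :
    nonadj a b -> W \subset [set w | e a w && e b w] ->
    sphere p W -> sphere p.+1 (a |: (b |: W)).

Definition sphere_free (p m : nat) (S : {set T}) : Prop :=
  forall W : {set T}, W \subset S -> #|W| <= m -> ~ sphere p W.

End Graph.

(** * Homology of spheres *)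

Section Chains.
Local Open Scope ring_scope.
Variables (K : fieldType) (n : nat).
Local Notation V := {set 'I_n}.
Implicit Types (z : V -> K) (G F : V) (v w : 'I_n).

Definition sgn w G : K := (-1) ^+ #|[set u in G | (u < w)%N]|.

(** A chain is a function on all vertex sets, of all degrees at once. [bdry z] lists the entries of
    the row vector of [z] times the matrix [bd], the empty set being the augmentation degree. *)
Definition bdry z G : K := \sum_(w | w \notin G) sgn w G * z (w |: G).

Definition cone v z G : K := if v \in G then sgn v (G :\ v) * z (G :\ v) else 0.

Lemma sgn_sq w G : sgn w G * sgn w G = 1.
Proof. by rewrite /sgn -expr2 sqrr_sign. Qed.

Lemma sgn_neq0 w G : sgn w G != 0.
Proof. by rewrite /sgn signr_eq0. Qed.

Lemma sgnU1 v w G : w \notin G ->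
  sgn v (w |: G) = (-1) ^+ (w < v)%N * sgn v G.
Proof.
move=> wG; rewrite /sgn -exprD; congr (_ ^+ _).
case: ltnP => wv.
  rewrite -(_ : w |: [set u in G | (u < v)%N] = [set u in w |: G | (u < v)%N]).
    by rewrite cardsU1 inE (negPf wG).
  by apply/setP => u; rewrite !inE; case: eqP => [->|].
rewrite add0n; apply: eq_card => u; rewrite !inE.
by case: eqP => [->|] //=; rewrite (negPf wG) ltnNge wv.
Qed.

(** The usual contraction of a cone. If [v] is not in [G], only the coface adding [v] contributes.
    If [v] is in [G], the terms cancel in pairs, because exactly one of [v < w] and [w < v] holds,
    so exchanging [v] and [w] changes the sign. *)
Lemma cone_homotopy v z : (forall G, v \in G -> z G = 0) ->
  forall G, bdry (cone v z) G + cone v (bdry z) G = z G.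
Proof.
move=> zv G; rewrite /bdry /cone; case: ifPn => vG; last first.
  rewrite addr0 (bigD1 v) //= setU11 setU1K // mulrA sgn_sq mul1r.
  rewrite big1 ?addr0 // => w /andP[_ wv].
  by rewrite !inE (negPf vG) eq_sym (negPf wv) mulr0.
rewrite (zv G) // [X in _ * X](bigD1 v) ?setD11 //=.
rewrite setD1K // (zv G) // mulr0 add0r mulr_sumr.
under [X in _ + X]eq_bigl => w.
  rewrite !inE negb_and negbK andb_orl andbN orFb andbC.
  rewrite (_ : _ && _ = (w \notin G)); last by case: eqP => [->|//]; rewrite vG.
  over.
rewrite -big_split big1 //= => w wG.
have wv : w != v by apply: contraNneq wG => ->.
have wGv : w \notin G :\ v by rewrite !inE (negPf wG) andbF.
rewrite !inE vG orbT (_ : (w |: G) :\ v = w |: (G :\ v)); last first.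
  by apply/setP => x; rewrite !inE; case: (x =P w) => [->|] //; rewrite wv.
rewrite -{1}(setD1K vG) (@sgnU1 v w) // (@sgnU1 w v) ?setD11 //.
have: ((v < w) = ~~ (w < v))%N.
  by rewrite -leqNgt ltn_neqAle; have := wv; rewrite -val_eqE eq_sym => ->.
move=> ->; rewrite !mulrA [sgn v _ * _]mulrC; case: (w < v)%N;
  by rewrite /= ?expr0 ?expr1 ?mul1r ?mulN1r ?mulrN1 ?mulrN ?mulr1 ?mulNr ?(addNr, addrN).
Qed.

Lemma bdryD z1 z2 G : bdry (fun F => z1 F + z2 F) G = bdry z1 G + bdry z2 G.
Proof. by rewrite /bdry -big_split; apply: eq_bigr => w _; rewrite mulrDr. Qed.

Lemma bdryB z1 z2 G : bdry (fun F => z1 F - z2 F) G = bdry z1 G - bdry z2 G.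
Proof. by rewrite /bdry -sumrB; apply: eq_bigr => w _; rewrite mulrBr. Qed.

Lemma bdry_sum (I : finType) (z : I -> V -> K) G :
  bdry (fun F => \sum_(i : I) z i F) G = \sum_(i : I) bdry (z i) G.
Proof.
by rewrite /bdry exchange_big; apply: eq_bigr => w _; rewrite mulr_sumr.
Qed.

Definition point v G : K := (G == [set v])%:R.

Lemma bdry_point v G : bdry (point v) G = (G == set0)%:R.
Proof.
rewrite /bdry /point; case: (altP (G =P set0)) => [->|G0].
  rewrite (bigD1 v) ?inE //= setU0 eqxx mulr1 big1 ?addr0 => [|w /andP[_ wv]].
    by rewrite /sgn (_ : #|_| = 0%N) ?expr0 //; apply: eq_card0 => u; rewrite !inE.
  by rewrite setU0 (inj_eq set1_inj) (negPf wv) mulr0.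
rewrite big1 // => w wG; case: eqP => [E|_]; last by rewrite mulr0.
case/set0Pn: G0 => x xG.
have xv : x \in [set v] by rewrite -E setU1r.
have wv : w \in [set v] by rewrite -E setU11.
by move: xv wv wG; rewrite !inE => /eqP <- /eqP ->; rewrite xG.
Qed.

(** [cone v (point K w)] is the oriented edge from [v] to [w], so the boundary can be read off from
    [cone_homotopy]. *)
Lemma bdry_edge v w G : v != w -> bdry (cone v (point w)) G = point w G - point v G.
Proof.
move=> vw; rewrite -[point w G](@cone_homotopy v); last first.
  move=> F vF; rewrite /point; case: eqP => // E.
  by move: vF vw; rewrite E inE => ->.
rewrite -addrA [X in _ + X](_ : _ = 0) ?addr0 //.
rewrite /cone /point; case: ifPn => vG; last first.
  by case: eqP vG => [->|]; rewrite ?inE ?eqxx // subr0.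
rewrite bdry_point -{3}(setD1K vG).
case: (altP (G :\ v =P set0)) => [->|G0].
  rewrite setU0 eqxx mulr1 /sgn (_ : #|_| = 0%N) ?expr0 ?subrr //.
  by apply: eq_card0 => u; rewrite !inE.
rewrite mulr0 sub0r; case: eqP => [E|]; last by rewrite oppr0.
by case/eqP: G0; move: E; rewrite setD1K // => ->; rewrite setDv.
Qed.

End Chains.

Section SphereHomology.
Local Open Scope ring_scope.
Variables (K : fieldType) (n : nat) (e : rel 'I_n).
Hypotheses (e_sym : symmetric e) (e_irr : irreflexive e).
Local Notation V := {set 'I_n}.

Lemma cone_point_neq0 (v w : 'I_n) (G : V) :
  cone v (point K w) G != 0 -> v != w -> G = [set v; w].
Proof.
rewrite /cone; case: ifP => vG; last by rewrite eqxx.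
rewrite /point; case: (G :\ v =P [set w]) => [E _ vw|_]; last by rewrite mulr0n mulr0 eqxx.
by rewrite -(setD1K vG) E.
Qed.

Lemma cone_point_edge (v w : 'I_n) : v != w -> cone v (point K w) [set v; w] != 0.
Proof.
move=> vw; rewrite /cone setU11 setU1K ?inE // /point eqxx mulr1.
exact: sgn_neq0.
Qed.

Lemma edge_clique (W : V) (v w : 'I_n) : v \in W -> w \in W -> e v w ->
  [set v; w] \in cliques e W 2.
Proof.
move=> vW wW vw; rewrite inE cards2; apply/and3P; split.
- by apply/subsetP => x; rewrite !inE => /orP[] /eqP->.
- apply/cliqueP => x y; rewrite !inE => /orP[] /eqP-> /orP[] /eqP->;
  by rewrite ?eqxx // e_sym.
- by case: (v =P w) vw => // ->; rewrite e_irr.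
Qed.

Lemma susp_clique_bound p a b (W : V) : nonadj e a b ->
  clique_bound e W p -> clique_bound e (a |: (b |: W)) p.+1.
Proof.
move=> /andP[ab nab] cW A /subsetP AW cA.
have [aA|aA] := boolP (a \in A); last first.
  apply: (@leq_trans #|b |: (A :\ b)|).
    by apply/subset_leq_card/subsetP => x xA; rewrite !inE xA andbT orbN.
  apply: leq_trans (leq_card_setU _ _) _; rewrite cards1 add1n ltnS.
  apply: cW; last by apply: clique_sub cA; apply: subsetDl.
  apply/subsetP => x; rewrite !inE => /andP[xb xA].
  have := AW x xA; rewrite !inE (negPf xb) /= => /orP[/eqP E|//].
  by rewrite -E xA in aA.
rewrite (cardsD1 a) aA add1n ltnS; apply: cW.
  apply/subsetP => x; rewrite !inE => /andP[xa xA].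
  have := AW x xA; rewrite !inE (negPf xa) /= => /orP[/eqP E|//].
  rewrite -E in ab nab; move/cliqueP: cA => /(_ a x aA xA).
  by rewrite eq_sym xa (negPf nab) => /(_ isT).
by apply: clique_sub cA; apply: subsetDl.
Qed.

Lemma clique_card_le2 (W : V) :
  (forall x y z, x \in W -> y \in W -> z \in W -> e x y -> e y z -> ~~ e x z) ->
  clique_bound e W 2.
Proof.
move=> tri A /subsetP AW /cliqueP cA; rewrite leqNgt; apply/negP.
case/card_gt2P => x [y [z [[xA yA zA] [xy yz zx]]]].
have := tri x y z (AW x xA) (AW y yA) (AW z zA) (cA x y xA yA xy) (cA y z yA zA yz).
by rewrite (cA x z) // eq_sym.
Qed.

(** A hole has no triangle: adjacent path vertices have consecutive indices, and [u] sees only the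
    two ends, which are not consecutive since [2 <= k]. In a suspension a clique contains at most
    one of the two poles. *)
Lemma sphere_clique_bound p (W : V) : sphere e p W -> clique_bound e W p.
Proof.
elim=> [|u f k k2 fe fi fn fu u0 uk un|{}p a b {}W ab Wab _ IH].
- by move=> A; rewrite subset0 => /eqP-> _; rewrite cards0.
- have fadj i j : (i <= k)%N -> (j <= k)%N -> e (f i) (f j) ->
      (i = j.+1 \/ j = i.+1)%N.
    move=> ik jk eij; case: (ltngtP i j) => ij.
    + case: (ltngtP i.+1 j) => ij2; [|lia|by right].
      by move: (fn _ _ ij2 jk); rewrite eij.
    + case: (ltngtP j.+1 i) => ij2; [|lia|by left].
      by move: (fn _ _ ij2 ik); rewrite e_sym eij.
    + by rewrite ij e_irr in eij.
  have uadj i : (i <= k)%N -> e u (f i) -> i = 0%N \/ i = k.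
    case: i => [|i] ik ei; first by left.
    right; case: (ltngtP i.+1 k) => // ik'; last lia.
    by move: (un i.+1 isT ik'); rewrite ei.
  have memW x : x \in u |: [set f (val j) | j : 'I_k.+1] ->
      x = u \/ exists2 j, (j <= k)%N & x = f j.
    rewrite !inE => /orP[/eqP|/imsetP[j _ ->]]; [by left|right].
    by exists j => //; rewrite -ltnS.
  apply: clique_card_le2 => x y z.
  move=> /memW[->|[i ik ->]] /memW[->|[j jk ->]] /memW[->|[l lk ->]];
    rewrite ?e_irr // => exy eyz; apply/negP => exz.
  + have := uadj _ jk exy; have := uadj _ lk exz; have := fadj _ _ jk lk eyz; lia.
  + rewrite e_sym in exy.
    have := uadj _ ik exy; have := uadj _ lk eyz; have := fadj _ _ ik lk exz; lia.
  + rewrite e_sym in eyz; rewrite e_sym in exz.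
    have := uadj _ jk eyz; have := uadj _ ik exz; have := fadj _ _ ik jk exy; lia.
  + have := fadj _ _ ik jk exy; have := fadj _ _ jk lk eyz.
    have := fadj _ _ ik lk exz; lia.
- exact: susp_clique_bound.
Qed.

Lemma cone_neq0_clique p (a : 'I_n) (W X : V) (z : V -> K) (G : V) :
  a \in X -> W \subset X -> {in W, forall w, e a w} ->
  (forall F, z F != 0 -> F \in cliques e W p) ->
  cone a z G != 0 -> G \in cliques e X p.+1.
Proof.
move=> aX WX aW zW; rewrite /cone; case: ifP => aG; last by rewrite eqxx.
rewrite mulf_eq0 (negPf (sgn_neq0 _ _ _)) /= => /zW.
rewrite !inE => /and3P[GW cG /eqP Gp]; apply/and3P; split.
- apply/subsetP => x xG; have [->//|xa] := eqVneq x a.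
  by apply: (subsetP WX); apply: (subsetP GW); rewrite !inE xa.
- apply/cliqueP => x y xG yG xy.
  have inW v : v \in G -> v != a -> v \in G :\ a by move=> vG va; rewrite !inE va.
  have [xa|xa] := eqVneq x a.
    by rewrite xa; apply/aW/(subsetP GW)/inW => //; rewrite -xa eq_sym.
  have [ya|ya] := eqVneq y a.
    by rewrite ya e_sym; apply/aW/(subsetP GW)/inW.
  by apply: (cliqueP _ _ cG) => //; apply: inW.
- by rewrite (cardsD1 a) aG Gp.
Qed.

Lemma bdry_cone_cycle (v : 'I_n) (z : V -> K) (G : V) :
  (forall F : V, v \in F -> z F = 0) -> (forall F, bdry z F = 0) ->
  bdry (cone v z) G = z G.
Proof.
move=> vz bz; rewrite -[RHS](cone_homotopy vz) /cone bz mulr0.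
by case: ifP; rewrite addr0.
Qed.

(** The fundamental cycle: the empty face, then the sum of the oriented edges around a hole, then
    the difference of the two cones over the cycle of the suspended sphere. *)
Lemma sphere_cycle p (W : V) : sphere e p W ->
  exists z : V -> K, [/\ exists G, z G != 0, forall G, bdry z G = 0
    & forall G, z G != 0 -> G \in cliques e W p].
Proof.
elim=> [|u f k k2 fe fi fn fu u0 uk un|{}p a b {}W ab Wab _ [z [[G0 zG0] bz zW]]].
- exists (fun G => (G == set0)%:R); split.
  + by exists set0; rewrite eqxx oner_eq0.
  + move=> G; rewrite /bdry big1 // => w _; case: eqP => [E|]; last by rewrite mulr0.
    by have := setU11 w G; rewrite E inE.
  + move=> G; case: (G =P set0) => [->|]; last by rewrite eqxx.
    rewrite inE sub0set cards0 eqxx andbT /= => _.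
    by apply/cliqueP => x y; rewrite inE.
(* [z1] is the path from [f 0] to [f k], whose boundary telescopes; the edges from [f k] to [u] and
   from [u] to [f 0] close it. *)
- pose z1 G := \sum_(j < k) cone (f j) (point K (f j.+1)) G.
  exists (fun G => z1 G + cone (f k) (point K u) G + cone u (point K (f 0%N)) G).
  have fu' j : (j <= k)%N -> u != f j by move=> /fu; rewrite eq_sym.
  set X := u |: _.
  have uX : u \in X by rewrite setU11.
  have fW j : (j <= k)%N -> f j \in X.
    rewrite -ltnS => jk; apply/setU1P; right.
    by apply/imsetP; exists (Ordinal jk).
  split.
  + exists [set u; f 0%N]; rewrite /z1 big1 ?add0r => [|j _].
      rewrite [X in X + _](_ : _ = 0) ?add0r ?cone_point_edge ?fu' //.
      apply/eqP/negPn/negP => /cone_point_neq0 /(_ (fu _ (leqnn k))) E.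
      have := set21 (f k) u; rewrite -E !inE (negPf (fu _ (leqnn k))) /=.
      by rewrite eq_sym (negPf (fi 0%N k _ _)) //; lia.
    apply/eqP/negPn/negP => /cone_point_neq0 E.
    have := set21 u (f 0%N); rewrite E ?fi // !inE.
    by rewrite (negPf (fu' _ _)) ?(negPf (fu' _ _)) // ltnW.
  + move=> G; rewrite !bdryD bdry_sum !bdry_edge ?fu ?fu' //.
    under eq_bigr => j _ do rewrite bdry_edge ?fi //.
    rewrite -(big_mkord xpredT (fun j => point K (f j.+1) G - point K (f j) G)).
    rewrite telescope_sumr //.
    by rewrite (addrC (_ - _) (point K u G - _)) !subrKA subrr.
  + move=> G; apply: contraNT => GX; rewrite /z1 big1 => [|j _].
      rewrite add0r; apply/eqP; rewrite -[RHS]addr0; congr (_ + _).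
        apply/eqP/negPn; apply: contra GX => /cone_point_neq0 ->; rewrite ?fu //.
        by apply: edge_clique => //; [apply: fW | rewrite e_sym].
      apply/eqP/negPn; apply: contra GX => /cone_point_neq0 ->; rewrite ?fu' //.
      by apply: edge_clique => //; apply: fW.
    apply/eqP/negPn; apply: contra GX => /cone_point_neq0 ->; rewrite ?fi //.
    by apply: edge_clique; [apply/fW/ltnW|apply: fW|apply: fe].
- have aW : {in W, forall w, e a w}.
    by move=> w /(subsetP Wab); rewrite inE => /andP[].
  have bW : {in W, forall w, e b w}.
    by move=> w /(subsetP Wab); rewrite inE => /andP[].
  have zout (v : 'I_n) : {in W, forall w, e v w} -> forall F : V, v \in F -> z F = 0.
    move=> vW F vF; apply/eqP/negPn/negP => /zW; rewrite inE => /and3P[FW _ _].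
    by have := vW v (subsetP FW v vF); rewrite e_irr.
  (* Both cones have boundary [z], since neither pole lies in [W]. At [a |: G0] the cone from [b]
     vanishes, so the difference is nonzero. *)
  exists (fun G => cone a z G - cone b z G); split.
  + exists (a |: G0); rewrite /cone setU11 setU1K.
      rewrite in_setU1 [b == a]eq_sym (negPf (proj1 (andP ab))) /=.
      case: ifP => bG; first by rewrite (zout b bW G0 bG) eqxx in zG0.
      by rewrite subr0 mulf_neq0 ?sgn_neq0.
    by apply/negP => aG; rewrite (zout a) ?eqxx in zG0.
  + move=> G; rewrite bdryB !bdry_cone_cycle ?subrr //.
      exact: zout.
    exact: zout.
  + move=> G; have [->|ca _] := eqVneq (cone a z G) 0.
      rewrite sub0r oppr_eq0; apply: cone_neq0_clique bW zW.
        by rewrite !inE eqxx orbT.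
      by apply/subsetP => x xW; rewrite !inE xW !orbT.
    apply: (cone_neq0_clique _ _ aW zW ca); first by rewrite setU11.
    by apply/subsetP => x xW; rewrite !inE xW !orbT.
Qed.

End SphereHomology.

(** * From the girth of a flag complex to forbidden spheres in its graph *)

Section Gamma.
Local Open Scope ring_scope.
Variables (n : nat) (Gamma : {set {set 'I_n}}).
Hypotheses (Gcx : is_complex Gamma) (Gv : all_vertices Gamma) (Gflag : is_flag Gamma).

Definition adj : rel 'I_n := fun u v => (u != v) && ([set u; v] \in Gamma).

Lemma adj_sym : symmetric adj.
Proof. by move=> u v; rewrite /adj eq_sym setUC. Qed.

Lemma adj_irr : irreflexive adj.
Proof. by move=> u; rewrite /adj eqxx. Qed.

Lemma clique_adj (A : {set 'I_n}) : clique adj A = (A \in Gamma).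
Proof.
apply/cliqueP/idP => [cA|AG u v uA vA uv].
  apply: Gflag => u v uA vA; have [->|uv] := eqVneq u v.
    by rewrite setUid; apply: Gv.
  by case/andP: (cA u v uA vA uv).
rewrite /adj uv; apply: Gcx AG _.
by apply/subsetP => x; rewrite !inE => /orP[] /eqP->.
Qed.

Lemma nfaces_cliques i : nfaces Gamma i = #|cliques adj setT i|.
Proof.
by apply: eq_card => A; rewrite !inE subsetT clique_adj.
Qed.

Variable K : fieldType.

(** Without faces on [j + 2] vertices the boundaries in degree [j] are zero, so a nonzero cycle is
    already a nonzero class. *)
Lemma homology_nonzero_top (Delta : {set {set 'I_n}}) j (z : {set 'I_n} -> K) :
  (forall G, G \in Delta -> #|G| <= j.+1)%N ->
  (exists G, z G != 0) -> (forall G, bdry z G = 0) ->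
  (forall G, z G != 0 -> G \in Delta /\ #|G| = j.+1) ->
  homology_nonzero K Delta j.
Proof.
move=> dD [G0 zG0] bz zD.
pose zv : 'rV[K]_(#|[set: {set 'I_n}]|) :=
  \row_i z (@enum_val _ [set: {set 'I_n}] i).
have zv0 : zv != 0.
  apply/eqP => /rowP /(_ (enum_rank_in (in_setT G0) G0)).
  by rewrite !mxE enum_rankK_in ?in_setT // => E; rewrite E eqxx in zG0.
rewrite /homology_nonzero (_ : chains K Delta j.+1 = 0); last first.
  apply/matrixP => x y; rewrite !mxE; case: ifP => [/andP[/dD h /eqP Ej]|].
    by rewrite Ej ltnn in h.
  by rewrite mul0rn.
rewrite mul0mx submx0; apply: contra zv0 => /eqP E.
rewrite -submx0 -E sub_capmx; apply/andP; split.
  apply/submxP; exists zv; apply/rowP => x.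
  rewrite mul_mx_diag !mxE.
  have [->|/zD[-> ->]] := eqVneq (z (enum_val x)) 0; first by rewrite mul0r.
  by rewrite eqxx mulr1.
apply/sub_kermxP/rowP => y; rewrite !mxE.
set G : {set 'I_n} := enum_val y.
rewrite (reindex (fun F => enum_rank_in (in_setT G0) F)) /=; last first.
  exists (fun i => enum_val i) => i _; last by rewrite enum_valK_in.
  by rewrite enum_rankK_in ?in_setT.
rewrite -[RHS](bz G) /bdry.
under eq_bigr => F _ do rewrite !mxE !enum_rankK_in ?in_setT // -/G.
rewrite (bigID [pred F : {set 'I_n} | (G \subset F) && (#|F :\: G| == 1)%N]) /=.
rewrite [X in _ + X]big1 ?addr0 => [|F /negPf->]; last by rewrite mulr0.
pose h F := z F * (-1) ^+ #|[set u in G | [exists v in F :\: G, u < v]%N]|.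
rewrite (eq_bigr h) => [|F ->//].
(* The nonzero entries of column [G] of [bd] sit at the sets [w |: G]; summing over [w] instead
   gives [bdry]. *)
rewrite (eq_bigl [in [set w |: G | w in ~: G]]) => [|F]; last first.
  apply/andP/imsetP => [[GF /cards1P[w Ew]]|[w]].
    exists w; first by have := set11 w; rewrite -Ew !inE => /andP[].
    apply/setP => x; rewrite -Ew !inE.
    by have [/(subsetP GF)->|] := boolP (x \in G); rewrite ?orbT ?orbF.
  rewrite inE => wG ->; split; first exact: subsetUr.
  rewrite setDUl setDv setU0 (_ : _ :\: _ = [set w]) ?cards1 //.
  by apply/setDidPl; rewrite disjoints1.
rewrite big_imset /= => [|w w']; last first.
  rewrite !inE => wG w'G Ew; have := setU11 w G.
  by rewrite Ew !inE (negPf wG) orbF => /eqP.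
apply: eq_big => [w|w]; rewrite inE // => wG.
rewrite /h mulrC; congr (_ * _); rewrite /sgn; congr (_ ^+ _).
apply: eq_card => u; rewrite !inE; congr (_ && _).
apply/exists_inP/idP => [[v]|uw].
  by rewrite !inE => /andP[/negPf vG]; rewrite vG orbF => /eqP->.
by exists w => //; rewrite !inE wG eqxx.
Qed.

(** The witness is the empty face, whose link is [Gamma]. Cliques on [p] vertices are faces of
    dimension [p - 1], hence the degree. *)
Lemma sphere_girth_witness p (W : {set 'I_n}) : (0 < p)%N -> set0 \in Gamma ->
  sphere adj p W -> W \in girth_witnesses K Gamma (p - 1).
Proof.
move=> p0 G0 sW; rewrite inE; apply/exists_inP; exists set0 => //.
have memD G : G \in induced (link Gamma set0) W = (G \in Gamma) && (G \subset W).
  rewrite inE; congr (_ && _); apply/imsetP/idP => [[F]|GG].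
    by rewrite inE => /andP[FG _] ->; rewrite setD0.
  by exists G; rewrite ?setD0 // inE GG sub0set.
have [z [z0 bz zW]] := sphere_cycle K adj_sym adj_irr sW.
apply: (homology_nonzero_top _ z0 bz) => G.
  rewrite memD -clique_adj => /andP[cG GW]; rewrite subn1 prednK //.
  exact: (sphere_clique_bound adj_sym adj_irr sW).
move=> /zW; rewrite memD inE -clique_adj subn1 prednK // => /and3P[-> -> /eqP] //.
Qed.

End Gamma.

(** * Density of nonadjacent pairs *)

Section Density.
Variables (T : finType) (e : rel T).
Hypotheses (e_sym : symmetric e) (e_irr : irreflexive e).
Implicit Types (A B I S W : {set T}).

Lemma clique_bound_sub A B d : A \subset B -> clique_bound e B d -> clique_bound e A d.
Proof. by move=> AB cB W WA; apply: cB; apply: subset_trans AB. Qed.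

Lemma sphere_free_sub p m A B :
  A \subset B -> sphere_free e p m B -> sphere_free e p m A.
Proof. by move=> AB cB W WA; apply: cB; apply: subset_trans AB. Qed.

Lemma sphere_free_leq p m1 m2 A :
  m1 <= m2 -> sphere_free e p m2 A -> sphere_free e p m1 A.
Proof. by move=> m12 cA W WA Wm; apply: cA => //; apply: leq_trans m12. Qed.

Lemma nbr_sub S v : nbr e S v \subset S.
Proof. by apply/subsetP => x; rewrite inE => /andP[]. Qed.

(** A sphere in the common neighbourhood can be suspended with poles [a] and [b], at the price of
    two vertices. This is how [p] decreases. *)
Lemma sphere_free_common p m S a b : a \in S -> b \in S -> nonadj e a b ->
  sphere_free e p.+1 m.+2 S -> sphere_free e p m (nbr e (nbr e S a) b).
Proof.
move=> aS bS ab fS W /subsetP WN Wm sW.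
apply: (fS (a |: (b |: W))).
- apply/subsetP => x; rewrite !inE => /or3P[/eqP->|/eqP->|/WN] //.
  by rewrite !inE => /andP[/andP[]].
- apply: leq_trans (leq_card_setU _ _) _; rewrite cards1 add1n ltnS.
  by apply: leq_trans (leq_card_setU _ _) _; rewrite cards1 add1n ltnS.
- apply: sphere_susp => //; apply/subsetP => x /WN.
  by rewrite !inE => /andP[/andP[_ ->]].
Qed.

Lemma sphere1_free_clique S : sphere_free e 1 2 S -> clique e S.
Proof.
move=> fS; apply/cliqueP => a b aS bS ab; apply/negPn/negP => nab.
have := @sphere_free_common 0 0 S a b aS bS; rewrite /nonadj ab nab => /(_ isT fS).
by move=> /(_ set0); rewrite sub0set cards0; apply=> //; apply: sphere_empty.
Qed.

(** Two nonadjacent common neighbours would form an induced 4-cycle with [a] and [b], so the common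
    neighbourhood is a clique. *)
Lemma common_nbr_bound S d a b : clique_bound e S d -> sphere_free e 2 4 S ->
  a \in S -> b \in S -> nonadj e a b -> #|nbr e (nbr e S a) b| <= d.
Proof.
move=> cS fS aS bS ab; apply: cS; last first.
  exact/sphere1_free_clique/sphere_free_common.
exact: subset_trans (nbr_sub _ _) (nbr_sub _ _).
Qed.

Definition nonnbr A x : {set T} := [set y in A | nonadj e x y].

Lemma not_clique_nonadj A : ~~ clique e A ->
  exists x y, [/\ x \in A, y \in A & nonadj e x y].
Proof.
case/forall_inPn => x xA /forall_inPn[y yA]; rewrite negb_imply => xy.
by exists x, y.
Qed.

(** Builds a cross-polytope: as [B] exceeds [d] it contains a nonadjacent pair, and passing to the
    common neighbourhood of that pair loses at most [2 * D.+1] vertices, the pair included. *)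
Lemma sphere_greedy p B d D : clique_bound e B d ->
  (forall x, x \in B -> #|nonnbr B x| <= D) ->
  d + 2 * D.+1 * p < #|B| ->
  exists W, [/\ W \subset B, #|W| <= 2 * p & sphere e p W].
Proof.
elim: p B => [|p IH] B cB dB hB.
  by exists set0; rewrite sub0set cards0; split=> //; apply: sphere_empty.
have /not_clique_nonadj[x [y [xB yB xy]]] : ~~ clique e B.
  by apply/negP => /(cB _ (subxx B)); lia.
pose B' := nbr e (nbr e B x) y.
have B'B : B' \subset B by exact: subset_trans (nbr_sub _ _) (nbr_sub _ _).
have card_B : #|B| <= #|B'| + (#|nonnbr B x|.+1 + #|nonnbr B y|.+1).
  apply: (@leq_trans #|B' :|: ((x |: nonnbr B x) :|: (y |: nonnbr B y))|).
    apply/subset_leq_card/subsetP => z zB; rewrite !inE zB /nonadj /=.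
    by rewrite ![z == _]eq_sym; case: (x == z) (y == z) (e x z) (e y z) => [] [] [] [].
  apply: leq_trans (leq_card_setU _ _) _; rewrite leq_add2l.
  apply: leq_trans (leq_card_setU _ _) _.
  by apply: leq_add; apply: leq_trans (leq_card_setU _ _) _; rewrite cards1.
have [|||W [WB' Wp sW]] := IH B'.
- exact: clique_bound_sub cB.
- move=> z zB'; apply: leq_trans (dB z (subsetP B'B z zB')).
  apply/subset_leq_card/subsetP => w; rewrite !inE => /andP[wB' ->].
  by rewrite (subsetP B'B) // !inE.
- by have := dB x xB; have := dB y yB; nia.
exists (x |: (y |: W)); split.
- apply/subsetP => z; rewrite !inE => /or3P[/eqP->|/eqP->|zW] //.
  exact: (subsetP B'B _ (subsetP WB' z zW)).
- apply: leq_trans (leq_card_setU _ _) _; rewrite cards1 mulnS !addSn add0n ltnS.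
  by apply: leq_trans (leq_card_setU _ _) _; rewrite cards1 add1n ltnS.
- apply: sphere_susp => //; apply/subsetP => z /(subsetP WB').
  by rewrite !inE => /andP[/andP[_ ->]].
Qed.

Lemma nonadj_density p A d : 0 < p -> 0 < d -> clique_bound e A d ->
  sphere_free e p (2 * p) A ->
  #|A| ^ 2 <= 16 * p * \sum_(x in A) #|nonnbr A x| + ((4 + 8 * p) * d) ^ 2.
Proof.
move=> p0 d0 cA fA.
have [Ad|dA] := leqP #|A| ((4 + 8 * p) * d).
  by apply: leq_trans (leq_addl _ _); rewrite leq_exp2r.
apply: leq_trans (leq_addr _ _).
(* [B] collects the vertices with few nonneighbours. If half of [A] lies outside [B], the sum is
   large enough; otherwise [B] is big enough for [sphere_greedy], since [8 * p * D <= #|A|] and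
   [4 * d + 8 * p < #|A|]. *)
pose B := [set x in A | 8 * p * #|nonnbr A x| <= #|A|].
have BA : B \subset A by apply/subsetP => x; rewrite inE => /andP[].
have cardAB := cardsID B A; rewrite (setIidPr BA) in cardAB.
have [AB|AB] := leqP #|A| (2 * #|A :\: B|).
  have : #|A :\: B| * #|A| <= 8 * p * \sum_(x in A) #|nonnbr A x|.
    rewrite -sum_nat_const big_distrr /= [X in _ <= X](big_setID B) /=.
    apply: leq_trans (leq_addl _ _); apply: leq_sum => x.
    by rewrite !inE => /andP[h xA]; rewrite xA /= -ltnNge in h; apply: ltnW.
  rewrite -mulnn; set s := \sum_(_ in _) _; set t := 8 * p * s => h.
  have -> : 16 * p * s = 2 * t by rewrite /t; lia.
  nia.
have [|||W [WB Wp sW]] := @sphere_greedy p B d (#|A| %/ (8 * p)).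
- exact: clique_bound_sub cA.
- move=> x; rewrite leq_divRL ?muln_gt0 ?p0 // inE [_ * (8 * p)]mulnC => /andP[_].
  apply: leq_trans; rewrite leq_mul2l; apply/orP; right.
  apply/subset_leq_card/subsetP => w; rewrite !inE => /andP[wB ->].
  by case/andP: wB => ->.
- have := leq_trunc_div #|A| (8 * p); set D := _ %/ _.
  have -> : D * (8 * p) = 8 * (D * p) by lia.
  have -> : 2 * D.+1 * p = 2 * (D * p) + 2 * p by lia.
  nia.
by case: (fA W _ Wp sW); apply: subset_trans BA.
Qed.

Definition indep I : bool := [forall x in I, forall y in I, ~~ e x y].

Lemma indepP I : reflect {in I &, forall x y, ~~ e x y} (indep I).
Proof.
apply: (iffP forall_inP) => [h x y xI yI | h x xI].
  by have /forall_inP := h x xI; apply.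
by apply/forall_inP => y yI; apply: h.
Qed.

Lemma indepU1 I y : indep I -> (forall x, x \in I -> ~~ e x y) -> indep (y |: I).
Proof.
move=> /indepP iI yI; apply/indepP => a b.
rewrite !inE => /orP[/eqP->|aI] /orP[/eqP->|bI]; rewrite ?e_irr //.
- by rewrite e_sym; apply: yI.
- exact: yI.
- exact: iI.
Qed.

(* Nonadjacent vertices have at most [d] common neighbours, so the
   neighbourhoods of an independent set are almost disjoint. *)
Lemma indep_deg_sum A I s d : I \subset A -> indep I -> #|I| <= s ->
  (forall x y, x \in A -> y \in A -> nonadj e x y -> #|nbr e (nbr e A x) y| <= d) ->
  \sum_(y in A) #|[set x in I | e x y]| * #|[set x in I | e x y]|.-1 <= s ^ 2 * d.
Proof.
move=> IA /indepP iI Is cA.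
have -> : \sum_(y in A) #|[set x in I | e x y]| * #|[set x in I | e x y]|.-1 =
  \sum_(x in I) \sum_(x' in I :\ x) #|nbr e (nbr e A x) x'|.
  transitivity (\sum_(y in A) \sum_(x in I) \sum_(x' in I :\ x) (e x y && e x' y : nat)).
    apply: eq_bigr => y yA; set C := [set x in I | e x y].
    transitivity (\sum_(x in C) #|C :\ x|).
      rewrite -sum_nat_const; apply: eq_bigr => x xC.
      by rewrite (cardsD1 x C) xC.
    rewrite [RHS](big_setID C) /= [X in _ = _ + X]big1 ?addn0 => [|x]; last first.
      rewrite !inE => /andP[xC xI]; rewrite xI /= in xC.
      by rewrite big1 // => x' _; rewrite (negPf xC).
    apply: eq_big => [x|x]; rewrite !inE; first by case: (x \in I).
    move=> /andP[xI ->]; rewrite -sum1_card big_mkcond [RHS]big_mkcond.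
    by apply: eq_bigr => z _; rewrite !inE; case: (z != x) (z \in I) (e z y) => [] [] [].
  rewrite exchange_big; apply: eq_bigr => x xI; rewrite exchange_big.
  apply: eq_bigr => x' _; rewrite -sum1_card big_mkcond [RHS]big_mkcond.
  by apply: eq_bigr => z _; rewrite !inE; case: (z \in A) (e x z) (e x' z) => [] [] [].
apply: (@leq_trans (\sum_(x in I) s * d)).
  apply: leq_sum => x xI; apply: (@leq_trans (\sum_(x' in I :\ x) d)).
    apply: leq_sum => x'; rewrite !inE => /andP[xx' x'I].
    by apply: cA; rewrite ?(subsetP IA) // /nonadj eq_sym xx' iI.
  rewrite sum_nat_const leq_mul2r; apply/orP; right; apply: leq_trans Is.
  exact/subset_leq_card/subsetDl.
by rewrite sum_nat_const -mulnn -mulnA leq_mul2r Is orbT.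
Qed.

Lemma sum_mem_leq A B : \sum_(y in A) (y \in B : nat) <= #|B|.
Proof.
rewrite -sum1_card [leqRHS]big_mkcond [leqLHS]big_mkcond /=.
by apply: leq_sum => y _; case: (y \in A) (y \in B) => [] [].
Qed.

(** Take an independent set [I] that is largest among those with at most [s] elements. If it has [s]
    elements, its neighbourhoods overlap so little that their average size is at most
    [2 * #|A| / s]. If it has fewer, it is maximal, and this forces [A] to be small. *)
Lemma low_degree_vertex A s d : 0 < s -> 0 < d -> clique_bound e A d ->
  (forall x y, x \in A -> y \in A -> nonadj e x y -> #|nbr e (nbr e A x) y| <= d) ->
  3 * s ^ 2 * d < #|A| ->
  exists2 x, x \in A & s * #|nbr e A x| <= 2 * #|A|.
Proof.
move=> s0 d0 cA comA bigA.
pose P I := [&& I \subset A, indep I & #|I| <= s].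
have P0 : P set0.
  by rewrite /P sub0set cards0 leq0n andbT; apply/indepP => x y; rewrite inE.
case: (@arg_maxnP _ set0 P (fun I => #|I|) P0) => I /and3P[IA iI Is] maxI.
pose c y := #|[set x in I | e x y]|.
have := indep_deg_sum IA iI Is comA; rewrite -/(c _) => pairs.
move: Is; rewrite leq_eqVlt => /orP[/eqP Is|Is].
  case: (pickP [pred x in A | s * #|nbr e A x| <= 2 * #|A|]) => [x /andP[xA h]|no].
    by exists x.
  have sum_c : \sum_(y in A) c y = \sum_(x in I) #|nbr e A x|.
    transitivity (\sum_(y in A) \sum_(x in I) (e x y : nat)).
      apply: eq_bigr => y _; rewrite /c -sum1_card big_mkcond [RHS]big_mkcond.
      by apply: eq_bigr => x _; rewrite inE; case: (x \in I) (e x y) => [] [].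
    rewrite exchange_big; apply: eq_bigr => x _.
    rewrite -sum1_card big_mkcond [RHS]big_mkcond.
    by apply: eq_bigr => y _; rewrite inE; case: (y \in A) (e x y) => [] [].
  (* Uses [c <= 1 + c * (c - 1)] for natural numbers. *)
  have up : \sum_(y in A) c y <= #|A| + s ^ 2 * d.
    apply: leq_trans (_ : \sum_(y in A) (1 + c y * (c y).-1) <= _).
      by apply: leq_sum => y _; case: (c y) => // m; nia.
    by rewrite big_split /= sum1_card leq_add2l.
  have lo : s * (2 * #|A|) <= s * \sum_(y in A) c y.
    rewrite sum_c -{1}Is -sum_nat_const big_distrr /=; apply: leq_sum => x xI.
    have := no x; rewrite /= (subsetP IA) //= => /negbT.
    by rewrite -ltnNge => /ltnW.
  rewrite leq_pmul2l // in lo; nia.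
(* The vertices outside [I] whose only neighbour in [I] is [x]. They form a clique, since replacing
   [x] by two nonadjacent ones would enlarge [I]. *)
pose priv x := [set y in A :\: I | [set z in I | e z y] == [set x]].
have priv_clique x : x \in I -> #|priv x| <= d.
  move=> xI; apply: cA; first by apply/subsetP => y; rewrite !inE => /andP[/andP[]].
  apply/cliqueP => y y' yp y'p yy'; apply/negPn/negP => nyy'.
  move: yp y'p; rewrite !inE => /andP[/andP[yI yA] /eqP Ny] /andP[/andP[y'I y'A] /eqP Ny'].
  have nadj z w : w \in A -> [set z in I | e z w] = [set x] -> z \in I :\ x -> ~~ e z w.
    move=> wA Nw; rewrite !inE => /andP[zx zI]; apply: contra zx => ezw.
    by rewrite -in_set1 -Nw inE zI.
  have /maxI : P (y |: (y' |: (I :\ x))).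
    have cardI : #|y |: (y' |: (I :\ x))| = #|I|.+1.
      by rewrite !cardsU1 !inE (negPf yy') (negPf yI) (negPf y'I) !andbF (cardsD1 x I) xI.
    rewrite /P cardI Is andbT; apply/andP; split.
      apply/subsetP => z; rewrite !inE => /or3P[/eqP->|/eqP->|/andP[_ zI]] //.
      exact: (subsetP IA).
    apply: indepU1 => [|z].
      apply: indepU1 => [|z]; last exact: nadj.
      by apply/indepP => a b /setD1P[_ aI] /setD1P[_ bI]; apply: (indepP _ iI).
    by rewrite in_setU1 => /orP[/eqP->|]; [rewrite e_sym | apply: nadj].
  rewrite !cardsU1 !inE (negPf yy') (negPf yI) (negPf y'I) !andbF (cardsD1 x I) xI /=.
  lia.
(* Each vertex of [A] is in [I], or has at least two neighbours in [I] and is counted by [pairs], or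
   is private to one vertex of [I]. *)
have cover : #|A| <= s + s ^ 2 * d + s * d.
  apply: (@leq_trans (\sum_(y in A) ((y \in I) + c y * (c y).-1 +
                                     \sum_(x in I) (y \in priv x : nat)))).
    rewrite -sum1_card; apply: leq_sum => y yA.
    have [//|yI] := boolP (y \in I).
    rewrite add0n; case Ec: (c y) => [|[|m]]; last by rewrite mulnS.
      have /maxI : P (y |: I).
        rewrite /P subUset sub1set yA IA /= cardsU1 yI add1n Is andbT.
        apply: indepU1 => // x xI; apply/negP => exy.
        by have := cards0_eq Ec; move/setP/(_ x); rewrite !inE xI exy.
      by rewrite cardsU1 yI; lia.
    move/eqP/cards1P: (Ec) => [x Ex].
    have xI : x \in I by have := set11 x; rewrite -Ex inE => /andP[].
    by rewrite (bigD1 x) //= inE Ex eqxx !inE yI yA.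
  rewrite !big_split /=; apply: leq_add; first apply: leq_add => //.
    exact: leq_trans (sum_mem_leq _ _) (ltnW Is).
  rewrite exchange_big /=; apply: leq_trans (_ : \sum_(x in I) d <= _).
    by apply: leq_sum => x xI; apply: leq_trans (priv_clique x xI); apply: sum_mem_leq.
  by rewrite sum_nat_const leq_mul2r ltnW ?orbT.
exfalso; nia.
Qed.

(** Delete low-degree vertices one by one. Each deletion lowers the degree sum by twice the degree
    removed, at most [4 * #|A| / s]; once [A] is small the trivial bound [#|A| ^ 2] is good
    enough. *)
Lemma adj_sum_bound A s d : 0 < s -> 0 < d -> clique_bound e A d ->
  sphere_free e 2 4 A ->
  s * (\sum_(x in A) #|nbr e A x|) <= #|A| * (4 * #|A| + 3 * s ^ 3 * d).
Proof.
move=> s0 d0.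
have [m] := ubnP #|A|; elim: m A => // m IH A Am cA fA.
have [Asmall|Abig] := leqP #|A| (3 * s ^ 2 * d).
  apply: (@leq_trans (s * \sum_(x in A) #|A|)).
    rewrite leq_mul2l; apply/orP; right; apply: leq_sum => x _.
    exact/subset_leq_card/nbr_sub.
  rewrite sum_nat_const mulnCA leq_mul2l; apply/orP; right.
  have -> : 3 * s ^ 3 * d = s * (3 * s ^ 2 * d) by rewrite [s ^ 3]expnS; lia.
  nia.
have [x xA degx] := low_degree_vertex s0 d0 cA
  (fun x y xA yA => common_nbr_bound cA fA xA yA) Abig.
have AxA : A :\ x \subset A by apply: subsetDl.
have := IH (A :\ x) _ (clique_bound_sub AxA cA) (sphere_free_sub AxA fA).
rewrite (cardsD1 x A) xA add1n ltnS in Am.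
move=> /(_ Am); set E' := \sum_(_ in A :\ x) _ => IHx.
have -> : \sum_(y in A) #|nbr e A y| = E' + 2 * #|nbr e A x|.
  rewrite (bigD1 x) //= (eq_bigl [in A :\ x]) => [|y]; last by rewrite !inE andbC.
  rewrite (eq_bigr (fun y => #|nbr e (A :\ x) y| + e x y)) => [|y]; last first.
    rewrite !inE => /andP[yx yA]; rewrite (cardsD1 x (nbr e A y)) inE xA /= addnC e_sym.
    by congr (_ + _); apply: eq_card => z; rewrite !inE andbA.
  rewrite big_split /= -/E'; set t := \sum_(_ in _) _.
  suff -> : t = #|nbr e A x| by lia.
  rewrite /t -sum1_card big_mkcond [RHS]big_mkcond; apply: eq_bigr => y _.
  rewrite !inE; have [->|_] := eqVneq y x; first by rewrite e_irr andbF.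
  by case: (y \in A) (e x y) => [] [].
rewrite (cardsD1 x A) xA in degx *.
move: IHx degx; set a := #|A :\ x|; set q := 3 * s ^ 3 * d; rewrite !add1n; nia.
Qed.

(** With [s = 12 * r] the edges use up at most five sixths of [#|A| ^ 2], and the last sixth pays
    for the diagonal. *)
Lemma local_density A r d : 0 < r -> 0 < d -> clique_bound e A d ->
  sphere_free e 2 4 A -> 3 * (12 * r) ^ 3 * d <= #|A| ->
  2 * r * (\sum_(x in A) #|x |: nbr e A x|) <= #|A| ^ 2.
Proof.
move=> r0 d0 cA fA bigA.
have := @adj_sum_bound A (12 * r) d _ d0 cA fA; rewrite muln_gt0 r0 => /(_ isT).
have -> : \sum_(x in A) #|x |: nbr e A x| = #|A| + \sum_(x in A) #|nbr e A x|.
  rewrite -sum1_card -big_split; apply: eq_bigr => x _.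
  by rewrite cardsU1 inE e_irr andbF.
set E := \sum_(_ in _) _; set q := _ * d in bigA *; rewrite -mulnn.
have : 12 * r <= q by rewrite /q !expnS; nia.
nia.
Qed.
End Density.

(** * Walks in graphs without short holes *)

Section Walks.
Variables (T : finType) (e : rel T).
Hypotheses (e_sym : symmetric e) (e_irr : irreflexive e).
Implicit Types (A B I S W : {set T}) (f h : nat -> T).

Definition walk S f k : Prop :=
  (forall j, j <= k -> f j \in S) /\ (forall j, j < k -> e (f j) (f j.+1)).

(** Shorten the walk along chords and repetitions until it is an induced path. Together with [u] it
    would be a hole on [k + 2 <= 2 * r] vertices if its ends were distinct and nonadjacent. *)
Lemma hole_free_walk r S u f k : 0 < r -> sphere_free e 2 (2 * r) S ->
  u \in S -> k <= 2 * r - 2 -> walk S f k -> e u (f 0) -> e u (f k) ->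
  (forall j, j <= k -> [\/ f j = f 0, f j = f k | nonadj e u (f j)]) ->
  ~~ nonadj e (f 0) (f k).
Proof.
move=> r0 fS uS; have [m] := ubnP k; elim: m k f => // m IH k f km kr [fin fe] u0 uk fn.
apply/negP => nad; case/andP: (nad) => n0k nad0k.
(* A chord from [f i] to [f (i + s).+1] bypasses [s] vertices; the shorter walk [g] has the same
   ends and contradicts the induction hypothesis. *)
have shortcut i s : 0 < s -> i + s < k -> e (f i) (f (i + s).+1) -> False.
  move=> s0 isk es; pose g t := if t <= i then f t else f (t + s).
  have gE j : j <= k - s -> exists2 j', j' <= k & g j = f j'.
    by move=> jk; rewrite /g; case: ifP => ji; [exists j | exists (j + s)] => //; lia.
  have gk : g (k - s) = f k by rewrite /g ifN ?subnK //; lia.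
  have /negP[] : ~~ nonadj e (g 0) (g (k - s)); last by rewrite gk.
  apply: IH; rewrite ?gk //.
  - lia.
  - lia.
  - split=> j jk; first by have [|j' j'k ->] := gE j; [lia | apply: fin].
    rewrite /g; case: ltngtP => ji.
    + by apply: fe; lia.
    + by rewrite addSn; apply: fe; lia.
    + by rewrite ji addSn.
  - by move=> j jk; have [j' j'k ->] := gE j jk; apply: fn.
(* A repetition [f i = f j] lets the walk stop at [i] when [j = k], and otherwise gives a chord from
   [f i] to [f j.+1]. *)
have dist i j : i < j -> j <= k -> f i != f j.
  move=> ij jk; apply/eqP => E; move: (jk); rewrite leq_eqVlt => /orP[/eqP jk'|jk'].
    have /negP[] : ~~ nonadj e (f 0) (f i); last by rewrite E jk'.
    apply: IH; rewrite ?E ?jk' //; try lia.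
      by split=> t ti; [apply: fin|apply: fe]; lia.
    by move=> t ti; apply: fn; lia.
  apply: (@shortcut i (j - i)); [lia|lia|].
  by rewrite subnKC ?(ltnW ij) // E; apply: fe.
have far i j : i.+1 < j -> j <= k -> ~~ e (f i) (f j).
  move=> ij jk; apply/negP => es; apply: (@shortcut i (j - i).-1); try lia.
  by have -> : (i + (j - i).-1).+1 = j by lia.
have k2 : 2 <= k.
  move: n0k nad0k fe; case: (k) => [|[|//]]; first by rewrite eqxx.
  by move=> _ /negP h fe; case: h; apply: fe.
have int j : 0 < j -> j < k -> nonadj e u (f j).
  move=> j0 jk; case: (fn j (ltnW jk)) => // E.
    by have := dist 0 j j0 (ltnW jk); rewrite E eqxx.
  by have := dist j k jk (leqnn k); rewrite E eqxx.
apply: (fS (u |: [set f (val j) | j : 'I_k.+1])).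
- apply/subsetP => x; rewrite !inE => /orP[/eqP->//|/imsetP[j _ ->]].
  by apply: fin; have := ltn_ord j; rewrite ltnS.
- apply: leq_trans (leq_card_setU _ _) _; rewrite cards1.
  apply: (@leq_trans (1 + k.+1)); last lia.
  by rewrite leq_add2l (leq_trans (leq_imset_card _ _)) ?card_ord.
- apply: sphere_hole => //.
    move=> j jk; apply/eqP => E.
    case: j E jk => [E|j E]; first by rewrite E e_irr in u0.
    rewrite leq_eqVlt => /orP[/eqP jk|jk]; first by rewrite -jk E e_irr in uk.
    by have := int _ (ltn0Sn j) jk; rewrite E /nonadj eqxx.
  by move=> j j0 jk; case/andP: (int j j0 jk).
Qed.

Definition trifree_walk S f k : Prop :=
  walk S f k /\ forall j, j.+1 < k -> nonadj e (f j) (f j.+2).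

(** Induction on [j - i]. If [f i] and [f j] were adjacent, [hole_free_walk] with [u = f i] would
    apply to the walk from [f i.+1] to [f j], whose ends are nonadjacent by induction. *)
Lemma trifree_walk_induced r S f k i j : 0 < r -> sphere_free e 2 (2 * r) S ->
  k <= 2 * r - 1 -> trifree_walk S f k -> i.+1 < j -> j <= k -> nonadj e (f i) (f j).
Proof.
move=> r0 fS kr [[fin fe] ft]; have [m] := ubnP (j - i).
elim: m i j => // m IH i j ijm ij jk.
have [->|ij2] := eqVneq j i.+2; first by apply: ft; lia.
have far : nonadj e (f i.+1) (f j) by apply: IH; lia.
apply/andP; split.
  apply/eqP => E; have /andP[_] : nonadj e (f i) (f j.-1) by apply: IH; lia.
  rewrite E e_sym -{2}(@prednK j); last lia.
  by rewrite fe //; lia.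
apply/negP => eij.
have /negP[] : ~~ nonadj e (f (i.+1 + 0)) (f (i.+1 + (j - i.+1)));
  last by rewrite addn0 subnKC ?(ltnW ij).
apply: (@hole_free_walk r S (f i) (fun t => f (i.+1 + t)) (j - i.+1) r0 fS).
- by apply: fin; lia.
- by lia.
- by split=> t tj; [apply: fin | rewrite addnS; apply: fe]; lia.
- by rewrite addn0; apply: fe; lia.
- by rewrite subnKC ?(ltnW ij).
- move=> t tj; case: (posnP t) => [->|t0]; first by rewrite addn0; constructor 1.
  have [->|tj'] := eqVneq t (j - i.+1); first by rewrite subnKC; [constructor 2 | lia].
  by constructor 3; apply: IH; lia.
Qed.

(** Go from [f 1] along [f] to the common end and back along [h] to [h 1]. This walk has length
    [2 * k <= 2 * r - 2], and apart from its ends it avoids the neighbours of [f 0], so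
    [hole_free_walk] applies. *)
Lemma trifree_walk_second r S f h k : 0 < r -> sphere_free e 2 (2 * r) S ->
  0 < k -> k.+1 <= r -> trifree_walk S f k.+1 -> trifree_walk S h k.+1 ->
  f 0 = h 0 -> f k.+1 = h k.+1 -> ~~ nonadj e (f 1) (h 1).
Proof.
move=> r0 fS k0 kr fw hw E0 Ek.
have find i j := @trifree_walk_induced r S f k.+1 i j r0 fS _ fw.
have hind i j := @trifree_walk_induced r S h k.+1 i j r0 fS _ hw.
case: fw hw => [[fin fe] _] [[hin he] _].
pose g t := if t <= k then f t.+1 else h (2 * k + 1 - t).
have g2k : g (2 * k) = h 1.
  by rewrite /g ifN; [congr h; lia | lia].
have := @hole_free_walk r S (f 0) g (2 * k) r0 fS; rewrite g2k; apply.
- exact: fin.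
- lia.
- split=> t tk; rewrite /g.
    by case: ifP => tk'; [apply: fin | apply: hin]; lia.
  case: ltngtP => tk'; first by apply: fe; lia.
    have -> : 2 * k + 1 - t = (2 * k + 1 - t.+1).+1 by lia.
    by rewrite e_sym; apply: he; lia.
  rewrite tk' Ek.
  have -> : 2 * k + 1 - k.+1 = k by lia.
  by rewrite e_sym; apply: he.
- by apply: fe.
- by rewrite E0; apply: he.
- move=> t tk; rewrite /g; case: ifP => tk'.
    case: (posnP t) => [->|t0]; first by constructor 1.
    by constructor 3; apply: find; lia.
  have [->|t2] := eqVneq t (2 * k); first by constructor 2; congr h; lia.
  by constructor 3; rewrite E0; apply: hind; lia.
Qed.

(** The number of ways to continue the directed edge (u, v) by [k] steps to [w] so that the whole
    walk is a [trifree_walk]. *)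
Fixpoint nwalks S k u v w : nat :=
  if k is k'.+1 then \sum_(x in nbr e S v | nonadj e u x) nwalks S k' v x w
  else v == w.

Lemma nwalks_walk S k u v w : u \in S -> v \in S -> e u v -> 0 < nwalks S k u v w ->
  exists f, [/\ trifree_walk S f k.+1, f 0 = u, f 1 = v & f k.+1 = w].
Proof.
elim: k u v => [|k IH] u v uS vS uv /=.
  rewrite lt0b => /eqP <-; exists (fun j => if j is 0 then u else v); split=> //.
  by split=> //; split; case=> [|[]].
rewrite lt0n sum_nat_eq0 negb_forall => /existsP[x].
rewrite negb_imply inE -lt0n => /andP[/andP[/andP[xS vx] ux] wx].
have [f [[[fin fe] ft] f0 f1 fk]] := IH v x vS xS vx wx.
exists (fun j => if j is j'.+1 then f j' else u); split=> //; split; first split.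
- by case.
- by case=> [|j] jk; [rewrite f0 | apply: fe].
- by case=> [|j] jk; [rewrite f1 | apply: ft].
Qed.

(** By [trifree_walk_second] the possible second vertices form a clique, so there are at most [d] of
    them; then induct from each. *)
Lemma nwalks_bound r S d k u w : 0 < r -> sphere_free e 2 (2 * r) S ->
  clique_bound e S d -> k < r -> u \in S ->
  \sum_(v in nbr e S u) nwalks S k u v w <= d ^ k.
Proof.
move=> r0 fS cS; elim: k u => [|k IH] u kr uS.
  rewrite expn0; apply: leq_trans (_ : \sum_(v in nbr e S u) (v \in [set w] : nat) <= _).
    by apply: leq_sum => v _; rewrite inE.
  by rewrite -(cards1 w); apply: sum_mem_leq.
pose A := [set v in nbr e S u | 0 < nwalks S k.+1 u v w].
have cA : #|A| <= d.
  apply: cS; first by apply/subsetP => v; rewrite !inE => /andP[/andP[]].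
  apply/cliqueP => v v'; rewrite !inE => /andP[/andP[vS uv] wv] /andP[/andP[v'S uv'] wv'] vv'.
  have [f [fw f0 f1 fk]] := nwalks_walk uS vS uv wv.
  have [h [hw h0 h1 hk]] := nwalks_walk uS v'S uv' wv'.
  have := trifree_walk_second r0 fS (ltn0Sn k) kr fw hw.
  rewrite f0 h0 fk hk f1 h1 /nonadj vv' negbK; exact.
rewrite (bigID [pred v | 0 < nwalks S k.+1 u v w]) /= [X in _ + X]big1 ?addn0; last first.
  by move=> v /andP[_]; rewrite -eqn0Ngt => /eqP.
rewrite expnS; apply: leq_trans (_ : \sum_(v in A) d ^ k <= _); last first.
  by rewrite sum_nat_const leq_mul2r cA orbT.
rewrite [leqRHS](eq_bigl (fun v => (v \in nbr e S u) && (0 < nwalks S k.+1 u v w)));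
  last by move=> v; rewrite inE.
apply: leq_sum => v /andP[]; rewrite inE => /andP[vS uv] _.
apply: leq_trans (IH v (ltnW kr) vS).
by rewrite /= [leqRHS](bigID [pred x | nonadj e u x]) leq_addr.
Qed.

Definition nwalks_from S k u v : nat := \sum_(w in S) nwalks S k u v w.

Lemma nwalks_from0 S u v : v \in S -> nwalks_from S 0 u v = 1.
Proof.
move=> vS; rewrite /nwalks_from (bigD1 v) //= eqxx big1 // => w /andP[_ wv].
by rewrite eq_sym (negPf wv).
Qed.

Lemma nwalks_fromS S k u v : nwalks_from S k.+1 u v =
  \sum_(x in nbr e S v | nonadj e u x) nwalks_from S k v x.
Proof. by rewrite /nwalks_from /= exchange_big. Qed.

Local Open Scope ring_scope.

(* Probability that [k] further steps of the simple random walk in [S], started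
   along the edge (u, v), never move to a vertex adjacent or equal to the
   previous-but-one. *)
Fixpoint walk_prob S k u v : rat :=
  if k is k'.+1 then
    #|nbr e S v|%:R^-1 * \sum_(x in nbr e S v | nonadj e u x) walk_prob S k' v x
  else 1.

Lemma walk_prob_ge0 S k u v : 0 <= walk_prob S k u v.
Proof.
elim: k u v => //= k IH u v; rewrite mulr_ge0 ?invr_ge0 ?ler0n //.
by apply: sumr_ge0.
Qed.

Lemma walk_prob_le1 S k u v : walk_prob S k u v <= 1.
Proof.
elim: k u v => //= k IH u v.
have [->|N0] := eqVneq #|nbr e S v| 0%N; first by rewrite invr0 mul0r.
rewrite mulrC ler_pdivrMr ?ltr0n ?lt0n // mul1r.
apply: le_trans (_ : \sum_(x in nbr e S v | nonadj e u x) 1 <= _).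
  by apply: ler_sum.
rewrite sumr_const ler_nat.
by apply/subset_leq_card/subsetP => x /andP[].
Qed.

(** Every step has probability at most [1 / D], so a walk of [k] steps has probability at most
    [D ^ -k]. *)
Lemma walk_prob_count S k u v (D : nat) : v \in S ->
  (forall x, x \in S -> (0 < D <= #|nbr e S x|)%N) ->
  D%:R ^+ k * walk_prob S k u v <= (nwalks_from S k u v)%:R.
Proof.
move=> vS dD; elim: k u v vS => [|k IH] u v vS.
  by rewrite nwalks_from0 //= mulr1.
have /andP[D0 Dv] := dD v vS.
have N0 : 0 < #|nbr e S v|%:R :> rat by rewrite ltr0n (leq_trans D0).
rewrite nwalks_fromS natr_sum /= exprSr -mulrA.
apply: le_trans (_ : \sum_(x in nbr e S v | nonadj e u x) D%:R ^+ k * walk_prob S k v x <= _).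
  rewrite -mulr_sumr; apply: ler_wpM2l; first by rewrite exprn_ge0 ?ler0n.
  rewrite mulrA; set t := \sum_(_ in _ | _) _.
  have t0 : 0 <= t by apply: sumr_ge0 => x _; apply: walk_prob_ge0.
  rewrite -[leRHS]mul1r; apply: ler_wpM2r => //.
  by rewrite ler_pdivrMr // mul1r ler_nat.
apply: ler_sum => x /andP[xN _]; apply: IH.
by move: xN; rewrite inE => /andP[].
Qed.

(* The uniform distribution on directed edges is stationary for the simple
   random walk, so each step loses at most a fraction 1/(2r) of the mass. *)
Lemma walk_prob_sum S k (r : nat) : (0 < r)%N ->
  (forall v, v \in S ->
    2 * r * \sum_(x in nbr e S v) #|x |: nbr e (nbr e S v) x| <= #|nbr e S v| ^ 2)%N ->
  (2 * r)%:R * (\sum_(u in S) \sum_(v in nbr e S u) walk_prob S k u v) >=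
  ((2 * r)%:R - k%:R) * (\sum_(u in S) #|nbr e S u|)%:R.
Proof.
move=> r0 dens; have r0' : 0 < (2 * r)%:R :> rat by rewrite ltr0n muln_gt0.
elim: k => [|k IH].
  rewrite subr0 natr_sum; under [in X in _ <= X]eq_bigr => u _ do rewrite sumr_const.
  by [].
have swap (F : T -> T -> rat) : \sum_(u in S) \sum_(v in nbr e S u) F u v =
    \sum_(v in S) \sum_(u in nbr e S v) F u v.
  rewrite (exchange_big_dep [in S]) /=; last by move=> u v _; rewrite inE => /andP[].
  apply: eq_bigr => v vS; apply: eq_bigl => u; rewrite !inE vS e_sym.
  by case: (u \in S).
(* Reversing the edges groups the walks by their second vertex [v], so that both neighbours of [v]
   on the walk range over the same set. *)
rewrite swap.
suff step v : v \in S -> (2 * r)%:R * \sum_(u in nbr e S v) walk_prob S k.+1 u v >=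
    (2 * r)%:R * (\sum_(x in nbr e S v) walk_prob S k v x) - #|nbr e S v|%:R.
  rewrite mulr_sumr; apply: (@le_trans _ _ (\sum_(v in S) ((2 * r)%:R *
    (\sum_(x in nbr e S v) walk_prob S k v x) - #|nbr e S v|%:R))).
    2: by apply: ler_sum.
  by rewrite sumrB -mulr_sumr -natr_sum -[k.+1]addn1 natrD opprD addrA mulrBl mul1r lerD2r.
move=> vS; set N := nbr e S v.
have [N0|N0] := eqVneq #|N| 0%N.
  by rewrite (cards0_eq N0) !big_set0 cards0 !mulr0 subr0.
have {}N0 : 0 < #|N|%:R :> rat by rewrite ltr0n lt0n.
rewrite /= -/N -mulr_sumr.
(* For a fixed next vertex [x], the predecessors [u] excluded are [x] and its neighbours within
   [N]. *)
have -> : \sum_(u in N) \sum_(x in N | nonadj e u x) walk_prob S k v x =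
    \sum_(x in N) (walk_prob S k v x * (#|N|%:R - #|x |: nbr e N x|%:R)).
  rewrite (exchange_big_dep [in N]) /=; last by move=> u x _ /andP[].
  apply: eq_bigr => x xN; rewrite sumr_const -[LHS]mulr_natr; congr (_ * _).
  rewrite -(cardsID (x |: nbr e N x) N) natrD (setIidPr _).
    rewrite addrAC subrr add0r; congr (_%:R); apply: eq_card => u.
    transitivity ((u \in N) && nonadj e u x); first by rewrite unfold_in /= xN.
    rewrite !inE /nonadj [e u x]e_sym.
    by case: (u \in S) (e v u) (u == x) (e x u) => [] [] [] [].
  by apply/subsetP => y /setU1P[->|] //; rewrite inE => /andP[].
rewrite [in leRHS](eq_bigr (fun x => walk_prob S k v x * #|N|%:R -
  walk_prob S k v x * #|x |: nbr e N x|%:R)); last by move=> x _; rewrite mulrBr.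
rewrite sumrB -mulr_suml [_^-1 * _]mulrBr.
set P := \sum_(_ in N) _; rewrite (mulrC P) mulKf ?(lt0r_neq0 N0) //.
rewrite mulrBr lerD2l lerN2 mulrCA ler_pdivrMl //.
apply: le_trans (_ : (2 * r)%:R * \sum_(x in N) #|x |: nbr e N x|%:R <= _).
  rewrite ler_pM2l //; apply: ler_sum => x _.
  by rewrite -[leRHS]mul1r ler_wpM2r ?ler0n ?walk_prob_le1.
by rewrite -natr_sum -!natrM ler_nat mulnn; apply: dens.
Qed.

Local Close Scope ring_scope.

(** Double counting of trifree walks with [r] edges: at most [d ^ r.-1] for each pair of ends, and
    at least [D ^ r.-1 / 2] per directed edge on average. *)
Lemma min_degree_bound r S d D : 0 < r -> 0 < D -> sphere_free e 2 (2 * r) S ->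
  clique_bound e S d -> (forall x, x \in S -> D <= #|nbr e S x|) -> S != set0 ->
  (forall v, v \in S ->
    2 * r * \sum_(x in nbr e S v) #|x |: nbr e (nbr e S v) x| <= #|nbr e S v| ^ 2) ->
  D ^ r <= 2 * #|S| * d ^ r.-1.
Proof.
move=> r0 D0 fS cS dD S0 dens.
pose N := \sum_(u in S) \sum_(v in nbr e S u) nwalks_from S r.-1 u v.
have upper : N <= #|S| * (#|S| * d ^ r.-1).
  rewrite -sum_nat_const; apply: leq_sum => u uS.
  rewrite exchange_big -sum_nat_const; apply: leq_sum => w _.
  by apply: (nwalks_bound _ r0 fS cS _ uS); rewrite prednK.
have lower : #|S| * D ^ r <= 2 * N.
  have := walk_prob_sum r.-1 r0 dens.
  set G := (\sum_(u in S) _)%R; set E := (\sum_(u in S) _)%N => h1.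
  have h2 : (D%:R ^+ r.-1 * G <= N%:R :> rat)%R.
    rewrite /N natr_sum mulr_sumr; apply: ler_sum => u uS.
    rewrite natr_sum mulr_sumr; apply: ler_sum => v; rewrite inE => /andP[vS _].
    by apply: walk_prob_count vS _ => x xS; rewrite D0 dD.
  have h3 : #|S| * D <= E by rewrite -sum_nat_const; apply: leq_sum.
  (* The [r - 1] steps lose at most [(r - 1) / (2 * r)] of the mass, which is less than one half. *)
  have h4 : (E%:R <= 2 * G :> rat)%R.
    have r0' : (0 < r%:R :> rat)%R by rewrite ltr0n.
    have E0 : (0 <= E%:R :> rat)%R by rewrite ler0n.
    have rE : (r%:R = r.-1%:R + 1 :> rat)%R by rewrite natr1 prednK.
    rewrite -(ler_pM2l r0') mulrCA mulrA -[(2 * r%:R)%R]natrM; apply: (le_trans _ h1).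
    rewrite -subr_ge0 -mulrBl mulr_ge0 // mul2n -addnn natrD addrAC addrK.
    by rewrite rE addrAC subrr add0r.
  have : ((#|S| * D ^ r)%:R <= (2 * N)%:R :> rat)%R; last by rewrite ler_nat.
  have Dr : (0 <= D%:R ^+ r.-1 :> rat)%R by rewrite exprn_ge0 ?ler0n.
  have h3' : ((#|S| * D)%:R <= E%:R :> rat)%R by rewrite ler_nat.
  rewrite -(prednK r0) expnSr mulnA (mulnAC #|S|) natrM natrX [(2 * N)%:R%R]natrM.
  rewrite [leLHS]mulrC; apply: le_trans (_ : D%:R ^+ r.-1 * (2 * G) <= _)%R.
    by apply: ler_wpM2l => //; apply: le_trans h4.
  by rewrite mulrCA; apply: ler_wpM2l; [rewrite ler0n | exact: h2].
have S1 : 0 < #|S| by rewrite card_gt0.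
rewrite -(leq_pmul2l S1); lia.
Qed.

Definition degen_const r := 3 * (12 * r) ^ 3.

(** Take a vertex of minimum degree [D]. If [D < Q * d], then [D ^ r <= #|S| * (Q * d) ^ r.-1]
    suffices; otherwise every neighbourhood is large enough for [local_density], and
    [min_degree_bound] applies. *)
Lemma degenerate_vertex r S d : 2 <= r -> 0 < d -> sphere_free e 2 (2 * r) S ->
  clique_bound e S d -> S != set0 ->
  exists2 v, v \in S & #|nbr e S v| ^ r <= degen_const r ^ r * #|S| * d ^ r.-1.
Proof.
move=> r2 d0 fS cS /set0Pn[v0 v0S].
have r0 : 0 < r by lia.
case: (@arg_minnP _ v0 [in S] (fun v => #|nbr e S v|) v0S) => v vS minv.
exists v => //; set D := #|_| in minv *; set Q := degen_const r.
have QE : Q = 3 * (12 * r) ^ 3 by [].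
have Q2 : 2 <= Q by rewrite QE !expnS; nia.
clearbody Q.
have [DQ|QD] := ltnP D (Q * d).
  rewrite -{1 2}(prednK r0) expnS expnSr.
  have r1 : 0 < r.-1 by clear -r2; lia.
  have : D ^ r.-1 <= (Q * d) ^ r.-1 by rewrite (leq_exp2r _ _ r1); apply: ltnW.
  have : D <= #|S| by apply/subset_leq_card/nbr_sub.
  rewrite expnMn; set x := D ^ _; set y := Q ^ _; set z := d ^ _ => h1 h2.
  apply: leq_trans (leq_mul h1 h2) _.
  have -> : y * Q * #|S| * z = (#|S| * (y * z)) * Q by lia.
  by rewrite leq_pmulr // ltnW.
apply: leq_trans (_ : 2 * #|S| * d ^ r.-1 <= _); last first.
  rewrite leq_mul2r; apply/orP; right; rewrite leq_mul2r; apply/orP; right.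
  by apply: (leq_trans Q2); apply: (leq_pexp2l (ltnW Q2) r0).
apply: min_degree_bound => //; first by apply: leq_trans QD; nia.
  by apply/set0Pn; exists v.
move=> x xS; apply: local_density d0 _ _ _ => //.
- exact: clique_bound_sub (nbr_sub _ _ _) cS.
- by apply: sphere_free_sub (nbr_sub _ _ _) (sphere_free_leq _ fS); lia.
- by rewrite -QE; apply: leq_trans QD (minv x xS).
Qed.

End Walks.

(** * Counting cliques through links *)

Lemma sqr_sum_leq (I : finType) (A : {set I}) (a : I -> nat) :
  (\sum_(s in A) a s) ^ 2 <= #|A| * \sum_(s in A) a s ^ 2.
Proof.
have : 2 * (\sum_(s in A) a s) ^ 2 <= 2 * (#|A| * \sum_(s in A) a s ^ 2).
  rewrite -mulnn big_distrlr /= big_distrr /=.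
  apply: leq_trans (_ : \sum_(s in A) \sum_(t in A) (a s ^ 2 + a t ^ 2) <= _).
    apply: leq_sum => s _; rewrite big_distrr /=; apply: leq_sum => t _.
    exact: nat_Cauchy.
  under eq_bigr => s _ do rewrite big_split sum_nat_const /=.
  by rewrite big_split -big_distrr sum_nat_const /= mul2n addnn.
by rewrite leq_pmul2l.
Qed.

Lemma leq_card_bigcup (I T : finType) (A : {set I}) (B : I -> {set T}) :
  #|\bigcup_(s in A) B s| <= \sum_(s in A) #|B s|.
Proof.
apply: (big_rec2 (fun (U : {set T}) m => #|U| <= m)); first by rewrite cards0.
by move=> s m U _ h; apply: leq_trans (leq_card_setU _ _) _; rewrite leq_add2l.
Qed.

Section Counting.
Variables (T : finType) (e : rel T).
Hypotheses (e_sym : symmetric e) (e_irr : irreflexive e).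
Implicit Types (A B I S W : {set T}).

Lemma card_cliques_leq S i : #|cliques e S i| <= #|S| ^ i.
Proof.
apply: (@leq_trans 'C(#|S|, i)).
  rewrite -cards_draws; apply/subset_leq_card/subsetP => A.
  by rewrite !inE => /and3P[-> _ ->].
apply: (@leq_trans (#|S| ^_ i)); first by rewrite -bin_ffact leq_pmulr ?fact_gt0.
by elim: i => // i IH; rewrite ffactnSr expnSr leq_mul ?leq_subr.
Qed.

Lemma clique_link S A v : A \in cliques e S #|A| -> v \in A ->
  A :\ v \in cliques e (nbr e S v) #|A|.-1.
Proof.
rewrite inE => /and3P[AS cA _] vA; rewrite inE; apply/and3P; split.
- apply/subsetP => x; rewrite !inE => /andP[xv xA].
  by rewrite (subsetP AS) //= (cliqueP _ _ cA) // eq_sym.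
- by apply: clique_sub cA; apply: subsetDl.
- by rewrite (cardsD1 v A) vA.
Qed.

Lemma cliques_delete S i v :
  #|cliques e S i.+1| <= #|cliques e (S :\ v) i.+1| + #|cliques e (nbr e S v) i|.
Proof.
apply: (@leq_trans #|cliques e (S :\ v) i.+1 :|:
    [set v |: A | A in cliques e (nbr e S v) i]|); last first.
  apply: leq_trans (leq_card_setU _ _) _; rewrite leq_add2l; exact: leq_imset_card.
apply/subset_leq_card/subsetP => A Acl; rewrite in_setU.
have cardA : #|A| = i.+1 by move: Acl; rewrite inE => /and3P[_ _ /eqP].
have [vA|vA] := boolP (v \in A); apply/orP; [right|left].
  apply/imsetP; exists (A :\ v); last by rewrite setD1K.
  by have := @clique_link S A v; rewrite cardA; apply.
move: Acl; rewrite !inE => /and3P[AS -> ->]; rewrite !andbT.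
apply/subsetP => x xA; rewrite !inE (subsetP AS) // andbT.
by apply: contraNneq vA => <-.
Qed.

Definition vlink S A : {set T} := [set v in S | [forall u in A, e u v]].

Lemma cliques_vlink S j : #|cliques e S j.+1| <= \sum_(A in cliques e S j) #|vlink S A|.
Proof.
apply: (@leq_trans #|\bigcup_(A in cliques e S j) [set v |: A | v in vlink S A]|).
  apply/subset_leq_card/subsetP => A; rewrite inE => /and3P[AS cA /eqP cardA].
  have [v vA] : exists v, v \in A by apply/set0Pn; rewrite -card_gt0 cardA.
  apply/bigcupP; exists (A :\ v).
    rewrite inE (subset_trans (subsetDl _ _) AS) (clique_sub (subsetDl _ _) cA) /=.
    by move: cardA; rewrite (cardsD1 v A) vA add1n => -[->].
  apply/imsetP; exists v; last by rewrite setD1K.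
  rewrite inE (subsetP AS) //=; apply/forall_inP => u /setD1P[uv uA].
  exact: (cliqueP _ _ cA).
apply: leq_trans (leq_card_bigcup _ _) _; apply: leq_sum => A _.
exact: leq_imset_card.
Qed.

Definition nonadj_cliques S j : nat :=
  \sum_(x in S) \sum_(y in S | nonadj e x y) #|cliques e (nbr e (nbr e S x) y) j|.

(** Double counting of triples (x, y, A): [x] and [y] lie in the link of [A] exactly when [A] lies
    in their common neighbourhood. *)
Lemma nonnbr_vlink_sum S j :
  \sum_(A in cliques e S j) \sum_(x in vlink S A) #|nonnbr e (vlink S A) x| <=
  nonadj_cliques S j.
Proof.
rewrite /nonadj_cliques.
pose t A x y : nat := (x \in vlink S A) && (y \in vlink S A).
apply: (@leq_trans (\sum_(A in cliques e S j) \sum_(x in S)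
    \sum_(y in S | nonadj e x y) t A x y)).
  apply: leq_sum => A _; rewrite big_mkcond [leqRHS]big_mkcond; apply: leq_sum => x _.
  case xl: (x \in vlink S A) => //; move: (xl); rewrite inE => /andP[-> _].
  rewrite -sum1_card big_mkcond [leqRHS]big_mkcond; apply: leq_sum => y _.
  rewrite inE /t xl /=; case yl: (y \in vlink S A) => //=.
  by move: yl; rewrite inE => /andP[-> _].
rewrite exchange_big; apply: leq_sum => x xS.
rewrite exchange_big; apply: leq_sum => y /andP[yS xy].
rewrite -sum1_card big_mkcond [leqRHS]big_mkcond; apply: leq_sum => A _.
case Acl: (A \in cliques e S j) => //; rewrite /t.
case: andP => [[xl yl]|//]; rewrite ifT //.
move: Acl xl yl; rewrite !inE => /and3P[AS -> ->] /andP[_ /forall_inP xA] /andP[_ /forall_inP yA].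
rewrite !andbT; apply/subsetP => u uA; rewrite !inE (subsetP AS) //=.
by rewrite e_sym xA // e_sym yA.
Qed.

Lemma vlink_sub S A : vlink S A \subset S.
Proof. by apply/subsetP => x; rewrite inE => /andP[]. Qed.

(** Cauchy-Schwarz over the [j]-cliques, then [nonadj_density] in the link of each. *)
Lemma cliques_recursion p S d j : 0 < p -> 0 < d -> clique_bound e S d ->
  sphere_free e p (2 * p) S ->
  #|cliques e S j.+1| ^ 2 <= #|cliques e S j| *
    (16 * p * nonadj_cliques S j + ((4 + 8 * p) * d) ^ 2 * #|cliques e S j|).
Proof.
move=> p0 d0 cS fS.
apply: (@leq_trans ((\sum_(A in cliques e S j) #|vlink S A|) ^ 2)).
  by rewrite leq_exp2r // cliques_vlink.
apply: leq_trans (sqr_sum_leq _ _) _; rewrite leq_mul2l; apply/orP; right.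
apply: (@leq_trans (\sum_(A in cliques e S j)
  (16 * p * (\sum_(x in vlink S A) #|nonnbr e (vlink S A) x|) + ((4 + 8 * p) * d) ^ 2))).
  apply: leq_sum => A _; apply: nonadj_density => //.
  - exact: clique_bound_sub (vlink_sub S A) cS.
  - exact: sphere_free_sub (vlink_sub S A) fS.
rewrite big_split /= -big_distrr sum_nat_const /= [_ * _ ^ 2]mulnC leq_add2r.
by rewrite leq_mul2l nonnbr_vlink_sum orbT.
Qed.

End Counting.

(** * The real exponents *)

Section Exponents.
Local Open Scope R_scope.

(** The form produced by the degeneracy argument: one factor [n] for the deleted vertex, and a
    neighbourhood whose size grows like [n] to the power [1 / r]. *)
Lemma a2_recr (r i : nat) : a2 r i.+1 = 1 + a2 r i / INR r.
Proof.
elim: i => [|i IH]; first by rewrite /= /Rdiv Rmult_0_l Rinv_1; lra.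
rewrite -[LHS]/(a2 r i.+1 + / (INR r ^ i.+1)) {1}IH.
rewrite -[a2 r i.+1]/(a2 r i + / (INR r ^ i)) /= Rinv_mult /Rdiv; lra.
Qed.

Lemma a2_ge0 (r i : nat) : (0 < r)%N -> 0 <= a2 r i.
Proof.
move=> r0; have r0' : 0 < INR r by apply: lt_0_INR; apply/ssrnat.ltP.
elim: i => [|i IH]; first by apply: Rle_refl.
have := Rinv_0_lt_compat _ (pow_lt _ i r0').
rewrite -[a2 r i.+1]/(a2 r i + / (INR r ^ i)); lra.
Qed.

Lemma a2_leS (r i : nat) : (0 < r)%N -> a2 r i <= a2 r i.+1.
Proof.
move=> r0; have r0' : 0 < INR r by apply: lt_0_INR; apply/ssrnat.ltP.
have := Rinv_0_lt_compat _ (pow_lt _ i r0').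
rewrite -[a2 r i.+1]/(a2 r i + / (INR r ^ i)); lra.
Qed.

Lemma a2_le (r i : nat) : (0 < r)%N -> a2 r i <= INR i.
Proof.
move=> r0; have r1 : 1 <= INR r by rewrite -[1]/(INR 1); apply/le_INR/ssrnat.leP.
elim: i => [|i IH]; first by apply: Rle_refl.
rewrite -[a2 r i.+1]/(a2 r i + / (INR r ^ i)) S_INR.
have := Rinv_le_contravar 1 (INR r ^ i) Rlt_0_1 (pow_R1_Rle _ _ r1); rewrite Rinv_1; lra.
Qed.

Lemma aexp2 (r i : nat) : aexp 2 r i = a2 r i.
Proof. by []. Qed.

Lemma aexp0 (p r : nat) : (2 <= p)%N -> aexp p r 0 = 0.
Proof. by case: p => [|[|[|p]]]. Qed.

Lemma aexp_low (p r i : nat) : (2 <= p)%N -> (0 < i <= p)%N -> aexp p.+1 r i = INR p.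
Proof.
case: p => [|[|p]] // _; case: i => // i /andP[_ ip].
by rewrite -[LHS]/(if Nat.leb i.+1 p.+2 then INR p.+2 else _) (introT (Nat.leb_spec0 _ _) (elimT ssrnat.leP ip)).
Qed.

Lemma aexp_recr (p r i : nat) : (2 <= p)%N -> (p <= i)%N ->
  aexp p.+1 r i.+1 = / 2 * aexp p r i + / 2 * aexp p.+1 r i + 1.
Proof.
case: p => [|[|p]] // _ ip.
rewrite -[LHS]/(if Nat.leb i.+1 p.+2 then INR p.+2 else
  / 2 * aexp p.+2 r i + / 2 * aexp p.+3 r i + 1).
by case: (Nat.leb_spec0 i.+1 p.+2) => // /ssrnat.leP; rewrite ltnNge ip.
Qed.

Lemma aexp_lower (p r i : nat) : (2 <= p)%N -> (0 < r)%N -> (0 < i)%N ->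
  INR p - 1 <= aexp p r i.
Proof.
move=> p2 r0; elim: p i p2 => // p IHp i; rewrite leq_eqVlt => /orP[/eqP<-|p2].
  case: i => // i _; rewrite aexp2 a2_recr.
  have r0' : 0 < INR r by apply: lt_0_INR; apply/ssrnat.ltP.
  have := Rmult_le_pos _ _ (a2_ge0 i r0) (Rlt_le _ _ (Rinv_0_lt_compat _ r0')).
  rewrite -/(Rdiv _ _) /=; lra.
elim: i => // i IHi _; rewrite S_INR.
have [ip|ip] := leqP i.+1 p; first by rewrite aexp_low //; lra.
have i0 : (0 < i)%N by lia.
rewrite aexp_recr //; have := IHp i p2 i0; have := IHi i0; rewrite S_INR; lra.
Qed.

Lemma aexp_ge0 (p r i : nat) : (2 <= p)%N -> (0 < r)%N -> 0 <= aexp p r i.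
Proof.
move=> p2 r0; case: i => [|i]; first by rewrite aexp0 //; lra.
have := @aexp_lower p r i.+1 p2 r0 isT.
have : INR 2 <= INR p by apply/le_INR/ssrnat.leP.
rewrite /=; lra.
Qed.

Lemma aexp_upper (p r i : nat) : (2 <= p)%N -> (0 < r)%N -> (p - 1 <= i)%N ->
  aexp p r i <= INR i.
Proof.
move=> p2 r0; elim: p i p2 => // p IHp i; rewrite leq_eqVlt => /orP[/eqP<-|p2].
  by move=> _; apply: a2_le.
rewrite subn1 succnK; elim: i => [|i IHi] ip; first by rewrite leqNgt ltnW in ip.
move: ip; rewrite leq_eqVlt => /orP[/eqP Ep|ip].
  by rewrite -Ep aexp_low; [apply: Rle_refl|lia|lia].
rewrite aexp_recr //; have := IHi ip.
have := IHp i p2 (leq_trans (leq_subr 1 p) ip); rewrite S_INR; lra.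
Qed.

(** By the recursion this is equivalent, for [p <= i], to monotonicity in [i] of the exponents for
    [p.+1], which [aexp_leS] extracts. *)
Lemma aexp_succ_le (p r i : nat) : (2 <= p)%N -> (0 < r)%N -> aexp p.+1 r i <= aexp p r i + 2.
Proof.
move=> p2 r0; elim: p i p2 => // p IHp i p2.
elim: i => [|i IHi]; first by rewrite !aexp0 //; lra.
have [ip|ip] := leqP i.+1 p.+1.
  rewrite aexp_low //; have := @aexp_lower p.+1 r i.+1 p2 r0 isT; lra.
rewrite aexp_recr //; move: p2 IHi; rewrite leq_eqVlt => /orP[/eqP Ep|p2] IHi.
  rewrite -Ep !aexp2 in IHi *; have := a2_leS i r0; lra.
have := IHp i p2; rewrite (@aexp_recr p) //; last exact: ltnW.
lra.
Qed.

Lemma aexp_leS (p r i : nat) : (2 <= p)%N -> (0 < r)%N -> (p <= i)%N ->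
  aexp p.+1 r i <= aexp p.+1 r i.+1.
Proof. by move=> p2 r0 ip; rewrite aexp_recr //; have := aexp_succ_le i p2 r0; lra. Qed.

End Exponents.

(** * The face bounds, by induction on p and i *)

Section Bounds.
Local Open Scope R_scope.

Lemma INR_expn (m k : nat) : INR (m ^ k)%N = INR m ^ k.
Proof. by elim: k => [|k IH]; rewrite ?expn0 // expnS mult_INR IH. Qed.

Lemma INR_gt0 (m : nat) : (0 < m)%N -> 0 < INR m.
Proof. by move=> m0; apply/lt_0_INR/ssrnat.ltP. Qed.

Lemma leq_INR (m k : nat) : (m <= k)%N -> INR m <= INR k.
Proof. by move=> mk; apply/le_INR/ssrnat.leP. Qed.

Lemma Rpower_gt0 x y : 0 < Rpower x y.
Proof. exact: exp_pos. Qed.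

(** [N] replaces [#|S|] so that one value serves all common neighbourhoods inside [S] and the base
    of [Rpower] stays positive when such a set is empty. *)
Definition face_bound (p r i : nat) (C : R) : Prop :=
  forall (T : finType) (e : rel T), symmetric e -> irreflexive e ->
  forall (S : {set T}) (d N : nat), (0 < d)%N -> (0 < N)%N -> (#|S| <= N)%N ->
  clique_bound e S d -> sphere_free e p (2 * p + 2 * r - 4) S ->
  INR #|cliques e S i| <=
    C * (Rpower (INR d) (INR i - aexp p r i) * Rpower (INR N) (aexp p r i)).

(** Deleting a vertex given by [degenerate_vertex] destroys at most [B] cliques. The hypothesis on
    [B] passes to subsets of [S], since the size limit only shrinks. *)
Lemma degenerate_face_bound (T : finType) (e : rel T) (S : {set T}) (r d i : nat) (B : R) :
  symmetric e -> irreflexive e -> (2 <= r)%N -> (0 < d)%N -> (0 < i)%N -> 0 <= B ->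
  clique_bound e S d -> sphere_free e 2 (2 * r) S ->
  (forall v, v \in S -> forall N : {set T}, N \subset S -> (0 < #|N|)%N ->
    (#|N| ^ r <= degen_const r ^ r * #|S| * d ^ r.-1)%N -> INR #|cliques e N i| <= B) ->
  INR #|cliques e S i.+1| <= INR #|S| * B.
Proof.
move=> es ei r2 d0 i0 B0; have [m] := ubnP #|S|; elim: m S => // m IH S Sm cS fS hB.
have [->|S0] := eqVneq S set0.
  have := card_cliques_leq e set0 i.+1; rewrite cards0 exp0n // leqn0 => /eqP->.
  by rewrite /= Rmult_0_l; apply: Rle_refl.
have [v vS degv] := degenerate_vertex es ei r2 d0 fS cS S0.
have SvS : S :\ v \subset S by apply: subsetDl.
have cardS : #|S| = (#|S :\ v|.+1)%N by rewrite (cardsD1 v S) vS.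
have IHv : INR #|cliques e (S :\ v) i.+1| <= INR #|S :\ v| * B.
  apply: IH; first by rewrite -ltnS -cardS.
  - exact: clique_bound_sub cS.
  - exact: sphere_free_sub fS.
  move=> w /setD1P[_ wS] N NS N0 hN; apply: (hB w wS N _ N0).
    exact: subset_trans SvS.
  apply: leq_trans hN _; rewrite leq_mul2r leq_mul2l (subset_leq_card SvS).
  by rewrite !orbT.
have Nv : INR #|cliques e (nbr e S v) i| <= B.
  have [N0|N0] := posnP #|nbr e S v|.
    have := card_cliques_leq e (nbr e S v) i; rewrite N0 exp0n // leqn0 => /eqP->.
    exact: B0.
  by apply: (hB v vS) => //; apply: nbr_sub.
have := leq_INR (cliques_delete e S i v); rewrite plus_INR cardS S_INR; lra.
Qed.

Lemma face_bound2 (r i : nat) : (2 <= r)%N -> (0 < i)%N ->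
  exists2 C, 0 <= C & face_bound 2 r i C.
Proof.
move=> r2; have r0 : (0 < r)%N by apply: ltnW.
have Rr : 0 < INR r by apply: INR_gt0.
elim: i => // -[|i] IH _.
  exists 1; first by lra.
  move=> T e es ei S d N d0 N0 SN _ _.
  rewrite aexp2 a2_recr /= /Rdiv Rmult_0_l Rplus_0_r.
  have -> : 1 - 1 = 0 by lra.
  rewrite Rpower_O ?Rpower_1; try exact: INR_gt0.
  rewrite !Rmult_1_l; apply: leq_INR; apply: leq_trans SN.
  by have := card_cliques_leq e S 1; rewrite expn1.
have [C C0 hC] := IH isT; set j := i.+1 in C0 hC *.
set a := aexp 2 r j in C0 hC.
pose K := INR (degen_const r ^ r)%N.
have K0 : 0 < K by apply: INR_gt0; rewrite expn_gt0 /degen_const muln_gt0 expn_gt0 muln_gt0 r0.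
have a0 : 0 <= a by apply: aexp_ge0.
exists (C * Rpower K (a / INR r)).
  by apply: Rmult_le_pos => //; apply/Rlt_le/Rpower_gt0.
move=> T e es ei S d N d0 N0 SN cS fS.
have fS2 : sphere_free e 2 (2 * r) S.
  by apply: sphere_free_leq fS; rewrite addnC -addnBA // addn0.
have Rd : 0 < INR d by apply: INR_gt0.
have RN : 0 < INR N by apply: INR_gt0.
(* [X] bounds the [r]-th power of the size of a degenerate neighbourhood, whence the exponent
   [a / INR r]. *)
pose X := K * INR N * INR d ^ r.-1.
have X0 : 0 < X by apply: Rmult_lt_0_compat; [apply: Rmult_lt_0_compat|apply: pow_lt].
pose B := C * (Rpower (INR d) (INR j - a) * Rpower X (a / INR r)).
have B0 : 0 <= B.
  by apply: Rmult_le_pos => //; apply: Rmult_le_pos; apply/Rlt_le/Rpower_gt0.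
have ar : 0 <= a / INR r.
  by apply: Rmult_le_pos => //; apply/Rlt_le/Rinv_0_lt_compat.
have hB : INR #|cliques e S j.+1| <= INR #|S| * B.
  apply: (degenerate_face_bound es ei r2 d0 _ B0 cS fS2) => //.
  move=> v vS D DS D0 hD.
  have := hC T e es ei D d #|D| d0 D0 (leqnn _) (clique_bound_sub DS cS) (sphere_free_sub DS fS).
  move=> /Rle_trans; apply; apply: Rmult_le_compat_l => //.
  apply: Rmult_le_compat_l; first exact/Rlt_le/Rpower_gt0.
  have RD : 0 < INR #|D| by apply: INR_gt0.
  have -> : Rpower (INR #|D|) a = Rpower (INR #|D| ^ r) (a / INR r).
    rewrite -Rpower_pow // Rpower_mult; congr Rpower; field; lra.
  apply: Rle_Rpower_l => //; split; first exact: pow_lt.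
  rewrite -INR_expn; apply: Rle_trans (leq_INR hD) _.
  rewrite !mult_INR -/K INR_expn; apply: Rmult_le_compat_r; first exact/Rlt_le/pow_lt.
  by apply: Rmult_le_compat_l; [apply: Rlt_le|apply: leq_INR].
apply: Rle_trans hB _; apply: (@Rle_trans _ (INR N * B)).
  by apply: Rmult_le_compat_r => //; apply: leq_INR.
have aE : aexp 2 r j.+1 = 1 + a / INR r by rewrite aexp2 a2_recr.
have XE : Rpower X (a / INR r) = Rpower K (a / INR r) * Rpower (INR N) (a / INR r) *
    Rpower (INR d) (a - a / INR r).
  rewrite /X -!Rpower_mult_distr //; try exact: pow_lt; last exact: Rmult_lt_0_compat.
  rewrite -Rpower_pow // Rpower_mult; congr (_ * Rpower _ _).
  have -> : INR r.-1 = INR r - 1 by rewrite -{2}(prednK r0) S_INR; lra.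
  field; lra.
apply: Req_le; rewrite /B XE aE S_INR Rpower_plus Rpower_1 //.
have -> : INR j + 1 - (1 + a / INR r) = (INR j - a) + (a - a / INR r) by lra.
rewrite (Rpower_plus (INR j - a)); ring.
Qed.

Lemma trivial_face_bound (d N j : nat) (a : R) : (0 < d)%N -> (0 < N <= d)%N ->
  a <= INR j -> INR (N ^ j)%N <= Rpower (INR d) (INR j - a) * Rpower (INR N) a.
Proof.
move=> d0 /andP[N0 Nd] aj; have RN := INR_gt0 N0; have RNd := leq_INR Nd.
have -> : INR (N ^ j)%N = Rpower (INR N) (INR j - a) * Rpower (INR N) a.
  rewrite INR_expn -Rpower_pow // -Rpower_plus; congr Rpower; lra.
apply: Rmult_le_compat_r; first exact/Rlt_le/Rpower_gt0.
by apply: Rle_Rpower_l; lra.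
Qed.

Lemma INR_sum_le (I : finType) (P : pred I) (F : I -> nat) (B : R) :
  (forall x, P x -> INR (F x) <= B) -> INR (\sum_(x | P x) F x) <= INR #|P| * B.
Proof.
move=> hF; rewrite -sum1_card.
apply: (big_rec2 (fun m k => INR m <= INR k * B)).
  by rewrite /= Rmult_0_l; apply: Rle_refl.
move=> x m k Px IH; rewrite !plus_INR; have := hF x Px; rewrite /=; lra.
Qed.

Lemma nonadj_cliques_bound (T : finType) (e : rel T) (S : {set T}) (j N : nat) (B : R) :
  (#|S| <= N)%N -> 0 <= B ->
  (forall x y, x \in S -> y \in S -> nonadj e x y ->
    INR #|cliques e (nbr e (nbr e S x) y) j| <= B) ->
  INR (nonadj_cliques e S j) <= INR N * INR N * B.
Proof.
move=> SN B0 hB; have RSN := leq_INR SN; have RS := pos_INR #|S|.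
apply: (@Rle_trans _ (INR #|S| * (INR #|S| * B))).
  apply: INR_sum_le => x xS; apply: (@Rle_trans _ (INR #|[pred y | (y \in S) && nonadj e x y]| * B)).
    by apply: INR_sum_le => y /andP[yS xy]; apply: hB.
  apply: Rmult_le_compat_r => //; apply/leq_INR/subset_leq_card/subsetP => y.
  by case/andP.
rewrite -Rmult_assoc; apply: Rmult_le_compat_r => //; nra.
Qed.

(** The square root of [cliques_recursion]: averaging the exponents for (p, i) and (p+1, i) and
    adding 1 for the factor [N ^ 2] gives the recursion of [aexp]. *)
Lemma face_bound_step (p r i : nat) (C1 C2 : R) : (2 <= p)%N -> (2 <= r)%N -> (p <= i)%N ->
  0 <= C1 -> 0 <= C2 -> face_bound p r i C1 -> face_bound p.+1 r i C2 ->
  exists2 C, 0 <= C & face_bound p.+1 r i.+1 C.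
Proof.
move=> p2 r2 pi C10 C20 h1 h2; have r0 : (0 < r)%N by apply: ltnW.
pose k1 := INR (16 * p.+1)%N; pose k2 := INR (4 + 8 * p.+1)%N.
have k10 : 0 <= k1 by apply: pos_INR.
(* The summand 1 ensures [C <= C ^ 2], which avoids roots of constants, and also covers the case
   [N <= d]. *)
pose C := k1 * C1 * C2 + k2 ^ 2 * C2 ^ 2 + 1.
have C0 : 1 <= C.
  have : 0 <= k1 * C1 * C2 by do !apply: Rmult_le_pos.
  by rewrite /C; nra.
exists C; first by lra.
move=> T e es ei S d N d0 N0 SN cS fS.
set b1 := aexp p r i in h1; set b2 := aexp p.+1 r i in h2.
have aE : aexp p.+1 r i.+1 = / 2 * b1 + / 2 * b2 + 1 by apply: aexp_recr.
have aS : b2 <= aexp p.+1 r i.+1 by apply: aexp_leS.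
have aU : aexp p.+1 r i.+1 <= INR i.+1.
  by apply: aexp_upper => //; lia.
set a := aexp p.+1 r i.+1 in aE aS aU *.
have RN := INR_gt0 N0; have Rd := INR_gt0 d0.
set Y := Rpower (INR d) (INR i.+1 - a) * Rpower (INR N) a.
have Y0 : 0 < Y by apply: Rmult_lt_0_compat; apply: Rpower_gt0.
have [Nd|dN] := leqP N d.
  apply: Rle_trans (leq_INR (card_cliques_leq e S i.+1)) _.
  apply: (@Rle_trans _ (INR (N ^ i.+1)%N)); first by apply: leq_INR; rewrite leq_exp2r.
  apply: (@Rle_trans _ Y); last by nra.
  by apply: trivial_face_bound => //; rewrite N0.
pose B1 := C1 * (Rpower (INR d) (INR i - b1) * Rpower (INR N) b1).
pose B2 := C2 * (Rpower (INR d) (INR i - b2) * Rpower (INR N) b2).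
have B10 : 0 <= B1.
  by apply: Rmult_le_pos => //; apply: Rmult_le_pos; apply/Rlt_le/Rpower_gt0.
have hB2 : INR #|cliques e S i| <= B2 by apply: h2.
have hB1 : INR (nonadj_cliques e S i) <= INR N * INR N * B1.
  apply: nonadj_cliques_bound => // x y xS yS xy.
  have NS : nbr e (nbr e S x) y \subset S by exact: subset_trans (nbr_sub _ _ _) (nbr_sub _ _ _).
  apply: h1 => //.
  - exact: leq_trans (subset_leq_card NS) SN.
  - exact: clique_bound_sub cS.
  - apply: sphere_free_common => //; apply: sphere_free_leq fS; lia.
have fS' : sphere_free e p.+1 (2 * p.+1) S by apply: sphere_free_leq fS; lia.
have rec : INR #|cliques e S i.+1| ^ 2 <= INR #|cliques e S i| *
    (k1 * INR (nonadj_cliques e S i) + (k2 * INR d) ^ 2 * INR #|cliques e S i|).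
  move: (cliques_recursion es i (ltn0Sn p) d0 cS fS'); rewrite /k1 /k2.
  move: (16 * p.+1)%N (4 + 8 * p.+1)%N => K1 K2 /leq_INR.
  by rewrite INR_expn mult_INR plus_INR (mult_INR K1) (mult_INR (_ ^ 2)%N) INR_expn (mult_INR K2).
have F0 := pos_INR #|cliques e S i|.
have B20 : 0 <= B2 by apply: Rle_trans hB2.
have {}rec : INR #|cliques e S i.+1| ^ 2 <=
    B2 * (k1 * (INR N * INR N * B1) + (k2 * INR d) ^ 2 * B2).
  apply: (Rle_trans _ _ _ rec); apply: Rmult_le_compat => //.
    apply: Rplus_le_le_0_compat; apply: Rmult_le_pos => //; first exact: pos_INR.
    exact: pow2_ge_0.
  by apply: Rplus_le_compat; apply: Rmult_le_compat_l => //; apply: pow2_ge_0.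
have dE : Rpower (INR d) (INR i - b1) * Rpower (INR d) (INR i - b2) =
    Rpower (INR d) (INR i.+1 - a) ^ 2.
  rewrite -Rpower_plus -Rsqr_pow2 /Rsqr -Rpower_plus aE S_INR; congr Rpower; lra.
have NE : Rpower (INR N) b1 * Rpower (INR N) b2 * (INR N * INR N) =
    Rpower (INR N) a ^ 2.
  rewrite -{3 4}(Rpower_1 _ RN) -Rsqr_pow2 /Rsqr -!Rpower_plus aE.
  congr Rpower; lra.
(* As [d < N] and [b2 <= a], the power [a - b2] may be moved from [d] to [N]. *)
have dY : INR d * (Rpower (INR d) (INR i - b2) * Rpower (INR N) b2) <= Y.
  rewrite -{1}(Rpower_1 _ Rd) -Rmult_assoc -Rpower_plus /Y.
  have -> : 1 + (INR i - b2) = (INR i.+1 - a) + (a - b2) by rewrite S_INR; lra.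
  have -> : Rpower (INR N) a = Rpower (INR N) (a - b2) * Rpower (INR N) b2.
    by rewrite -Rpower_plus; congr Rpower; lra.
  rewrite Rpower_plus Rmult_assoc; apply: Rmult_le_compat_l; first exact/Rlt_le/Rpower_gt0.
  apply: Rmult_le_compat_r; first exact/Rlt_le/Rpower_gt0.
  by apply: Rle_Rpower_l; [lra | split=> //; apply/leq_INR/ltnW].
have dY0 : 0 <= INR d * (Rpower (INR d) (INR i - b2) * Rpower (INR N) b2).
  by apply: Rmult_le_pos; [apply: Rlt_le | apply: Rmult_le_pos; apply/Rlt_le/Rpower_gt0].
have main : B2 * (k1 * (INR N * INR N * B1) + (k2 * INR d) ^ 2 * B2) =
    k1 * C1 * C2 * Y ^ 2 +
    k2 ^ 2 * C2 ^ 2 * (INR d * (Rpower (INR d) (INR i - b2) * Rpower (INR N) b2)) ^ 2.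
  have -> : Y ^ 2 = Rpower (INR d) (INR i.+1 - a) ^ 2 * Rpower (INR N) a ^ 2.
    by rewrite /Y Rpow_mult_distr.
  rewrite -dE -NE /B1 /B2; ring.
have sq : INR #|cliques e S i.+1| ^ 2 <= (C * Y) ^ 2.
  apply: (Rle_trans _ _ _ rec); rewrite main.
  apply: (@Rle_trans _ (k1 * C1 * C2 * Y ^ 2 + k2 ^ 2 * C2 ^ 2 * Y ^ 2)).
    apply: Rplus_le_compat_l; apply: Rmult_le_compat_l.
      by apply: Rmult_le_pos; apply: pow2_ge_0.
    by apply: pow_incr.
  have Y2 := pow2_ge_0 Y; rewrite Rpow_mult_distr.
  apply: (@Rle_trans _ (C * Y ^ 2)); first by rewrite /C; nra.
  by apply: Rmult_le_compat_r => //; nra.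
apply: Rsqr_incr_0_var; last by apply: Rmult_le_pos; lra.
by rewrite !Rsqr_pow2.
Qed.

Lemma face_bound_exists (p r i : nat) :
  (2 <= p)%N -> (2 <= r)%N -> (p - 1 <= i)%N -> (0 < i)%N ->
  exists2 C, 0 <= C & face_bound p r i C.
Proof.
move=> p2 r2; elim: p i p2 => // p IHp i; rewrite leq_eqVlt => /orP[/eqP<- _|p2].
  exact: face_bound2.
rewrite subn1 succnK; elim: i => // i IHi pi _.
move: pi; rewrite leq_eqVlt => /orP[/eqP Ep|pi].
  (* At the first index the exponent equals [i], and the bound is the trivial [N ^ i]. *)
  exists 1; first lra.
  move=> T e es ei S d N d0 N0 SN _ _.
  rewrite -Ep aexp_low ?leqnn ?andbT; try lia.
  rewrite Rminus_diag Rpower_O ?Rmult_1_l; last exact: INR_gt0.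
  rewrite Rpower_pow; last exact: INR_gt0.
  rewrite -INR_expn; apply: leq_INR; apply: leq_trans (card_cliques_leq e S p) _.
  by rewrite leq_exp2r //; lia.
have [C1 C10 h1] : exists2 C, 0 <= C & face_bound p r i C by apply: IHp; lia.
have [C2 C20 h2] : exists2 C, 0 <= C & face_bound p.+1 r i C by apply: IHi; lia.
by apply: (face_bound_step _ _ _ C10 C20 h1 h2).
Qed.

End Bounds.

Theorem mainTheorem10 :
  forall p r i : nat, (2 <= p)%N -> (2 <= r)%N -> (p - 1 <= i)%N -> (1 <= i)%N ->
  exists C : R,
    forall (K : fieldType) (n d : nat) (Gamma : {set {set 'I_n}}),
      is_complex Gamma -> all_vertices Gamma -> has_dim_pred Gamma d ->
      is_flag Gamma ->
      girth_gt K Gamma (p - 1) (2 * p + 2 * r - 4) ->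
      Rle (INR (nfaces Gamma i))
          (Rmult C (Rmult (Rpower (INR d) (Rminus (INR i) (aexp p r i)))
                          (Rpower (INR n) (aexp p r i)))).
Proof.
move=> p r i p2 r2 pi i0; have [C C0 hC] := face_bound_exists p2 r2 pi i0.
exists C => K n d Gamma Gcx Gv [dimle [F FG Fd]] Gflag Ggirth.
rewrite (nfaces_cliques Gcx Gv Gflag).
(* For [n = 0] there are no cliques of positive size, and [Rpower] is positive even at base 0. *)
have [n0|n0] := posnP n.
  have -> : #|cliques (adj Gamma) setT i| = 0%N.
    apply/eqP; rewrite -leqn0; apply: leq_trans (card_cliques_leq _ _ _) _.
    by rewrite (_ : #|_| = 0%N) ?exp0n // cardsT card_ord.
  by do 2?[apply: Rmult_le_pos => //]; apply/Rlt_le/Rpower_gt0.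
have d0 : (0 < d)%N by have := dimle _ (Gv (Ordinal n0)); rewrite cards1.
apply: hC => //; first exact: adj_sym; first exact: adj_irr.
- by rewrite cardsT card_ord.
- by move=> A _; rewrite (clique_adj Gcx Gv Gflag); apply: dimle.
- move=> W _ Wm sW; suff /Ggirth : W \in girth_witnesses K Gamma (p - 1).
    by rewrite ltnNge Wm.
  apply: sphere_girth_witness => //; first exact: ltnW.
  exact: Gcx FG (sub0set F).
Qed.
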